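(* Let $K$ be a complete, algebraically closed nonarchimedean valued field and let $\varphi(z)\in K(z)$ have degree $d\ge 1$. Then $$\mathrm{Lip}_{\mathbf P^1(K)}(\varphi)\le \frac{1}{|\mathrm{Res}(\varphi)|},\qquad \mathrm{Lip}_{\mathrm{Berk}}(\varphi)\le \max\Big(\frac{d}{|\mathrm{Res}(\varphi)|},\ \frac{1}{|\mathrm{Res}(\varphi)|^{d}}\Big).$$
   Context: $K$ is a complete, algebraically closed field with a nontrivial nonarchimedean absolute value $|\cdot|$; $\mathcal O=\{z\in K:|z|\le 1\}$ is its valuation ring, $\mathcal O^\times$ its unit group. Fix $q>1$ and write $\log=\log_q$. $\mathbf P^1_{\mathrm{Berk}}$ is the Berkovich projective line over $K$: a uniquely path-connected space (a tree) containing $\mathbf P^1(K)=K\cup\{\infty\}$; for $a\in K$, $r>0$, $\zeta_{a,r}$ is the point corresponding to the disc $D(a,r)=\{z\in K:|z-a|\le r\}$ (so $\zeta_{a,r}=\zeta_{b,r}$ iff $|a-b|\le r$), and $\zeta_{a,0}=a$; $\zeta_G=\zeta_{0,1}$ is the Gauss point; $[x,y]$ denotes the unique path from $x$ to $y$. On $\mathbf H^1=\mathbf P^1_{\mathrm{Berk}}\setminus\mathbf P^1(K)$ the logarithmic path metric $\rho$ gives the path $\{\zeta_{a,r}:R_1\le r\le R_2\}$ length $\log(R_2/R_1)$. Define $\mathrm{diam}_G(x)=q^{-\rho(\zeta_G,x)}$ for $x\in\mathbf H^1$ and $\mathrm{diam}_G(x)=0$ for $x\in\mathbf P^1(K)$;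 explicitly $\mathrm{diam}_G(\zeta_{a,r})=r/\max(1,|a|,r)^2$. Let $x\vee_G y$ be the first point where the paths $[x,\zeta_G]$ and $[y,\zeta_G]$ meet, and define the Favre–Rivera-Letelier metric $d(x,y)=2\,\mathrm{diam}_G(x\vee_G y)-\mathrm{diam}_G(x)-\mathrm{diam}_G(y)$. The spherical metric on $\mathbf P^1(K)$ is $\|x,y\|=|x-y|/(\max(1,|x|)\max(1,|y|))$ for $x,y\in K$ and $\|x,\infty\|=1/\max(1,|x|)$. A nonconstant $\varphi\in K(z)$ acts continuously on $\mathbf P^1_{\mathrm{Berk}}$, extending its action on $\mathbf P^1(K)$. Define $\mathrm{Lip}_{\mathrm{Berk}}(\varphi)=\sup_{x\ne y\in\mathbf P^1_{\mathrm{Berk}}} d(\varphi(x),\varphi(y))/d(x,y)$ and $\mathrm{Lip}_{\mathbf P^1(K)}(\varphi)=\sup_{x\ne y\in\mathbf P^1(K)}\|\varphi(x),\varphi(y)\|/\|x,y\|$. A normalized representation of $\varphi$ is a pair of homogeneous $F,G\in\mathcal O[X,Y]$ of degree $d$, with no common factor, at least one coefficient in $\mathcal O^\times$, such that $\varphi([X:Y])=[F(X,Y):G(X,Y)]$ (with $z=X/Y$); $|\mathrm{Res}(\varphi)|:=|\mathrm{Res}(F,G)|$ (the usual Sylvester resultant of the coefficient sequences), which is independent of the choice of normalized representation. *)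

(* Defs.v *)
From HB Require Import structures.
From mathcomp Require Import all_boot all_order all_algebra.
From Stdlib Require Import Reals ClassicalEpsilon.

Set Implicit Arguments.
Unset Strict Implicit.
Unset Printing Implicit Defensive.

Import GRing.Theory.

Section Defs.
Local Open Scope ring_scope.

Variable K : closedFieldType.
Variable av : K -> R.

Definition is_na_abs : Prop :=
  (forall x : K, Rle R0 (av x)) /\
  (forall x : K, av x = R0 <-> x = 0) /\
  (forall x y : K, av (x * y) = Rmult (av x) (av y)) /\
  (forall x y : K, Rle (av (x + y)) (Rmax (av x) (av y))).

Definition nontrivial_abs : Prop :=
  exists x : K, av x <> R0 /\ av x <> R1.

Definition abs_Cauchy (u : nat -> K) : Prop :=
  forall eps : R, Rlt R0 eps ->
    exists N : nat, forall m n : nat, le N m -> le N n -> Rlt (av (u m - u n)) eps.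

Definition abs_complete : Prop :=
  forall u : nat -> K, abs_Cauchy u ->
    exists l : K, forall eps : R, Rlt R0 eps ->
      exists N : nat, forall n : nat, le N n -> Rlt (av (u n - l)) eps.

Definition complete_na_abs : Prop :=
  is_na_abs /\ nontrivial_abs /\ abs_complete.

(* ---------- rational maps via normalized representations ----------
   A homogeneous form F(X,Y) of degree d is represented by its
   dehomogenization f(z) = F(z,1), a polynomial with size f <= d+1;
   the coefficient f`_i is the coefficient of X^i Y^(d-i). *)

Definition in_O (c : K) : Prop := Rle (av c) R1.

Definition normalized_rep (d : nat) (f g : {poly K}) : Prop :=
  [/\ leq (size f) d.+1, leq (size g) d.+1,
      (* F and G have no common factor: no common affine factor, and
         Y does not divide both *)
      coprimep f g /\ ((size f == d.+1) || (size g == d.+1)),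
      (forall i, in_O f`_i) /\ (forall i, in_O g`_i)
    & exists i, av f`_i = R1 \/ av g`_i = R1].

(* Sylvester matrix of the coefficient sequences of two forms of degree d
   (coefficients listed in increasing order; only the sign of the
   determinant depends on this choice). *)
Definition sylvester (d : nat) (f g : {poly K}) : 'M[K]_(d + d) :=
  \matrix_(i < d + d, j < d + d)
    if ltn i d then (if leq i j then f`_(subn j i) else 0)
    else (if leq (subn i d) j then g`_(subn j (subn i d)) else 0).

Definition Res (d : nat) (f g : {poly K}) : K := \det (sylvester d f g).

(* None = infinity *)
Definition P1K := option K.

Definition sph (x y : P1K) : R :=
  match x, y with
  | Some a, Some b => Rdiv (av (a - b)) (Rmult (Rmax R1 (av a)) (Rmax R1 (av b)))
  | Some a, None | None, Some a => Rdiv R1 (Rmax R1 (av a))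
  | None, None => R0
  end.

Definition phiK (d : nat) (f g : {poly K}) (x : P1K) : P1K :=
  match x with
  | None => if g`_d != 0 then Some (f`_d / g`_d) else None
  | Some a => if g.[a] != 0 then Some (f.[a] / g.[a]) else None
  end.

(* ---------- the Berkovich projective line ----------
   A^1_Berk = multiplicative seminorms on K[T] extending |.| on K;
   P^1_Berk = A^1_Berk together with the point infinity (None). *)

Definition seminorm := {poly K} -> R.

Definition is_mult_seminorm (s : seminorm) : Prop :=
  [/\ forall h, Rle R0 (s h),
      forall h1 h2, s (h1 * h2) = Rmult (s h1) (s h2),
      forall h1 h2, Rle (s (h1 + h2)) (Rplus (s h1) (s h2))
    & forall c : K, s c%:P = av c].

Definition BPt := option seminorm.

Definition isBerk (x : BPt) : Prop :=
  match x with None => True | Some s => is_mult_seminorm s end.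

Definition evalSemi (a : K) : seminorm := fun h => av h.[a].

Definition gaussNorm : seminorm := fun h => \big[Rmax/R0]_(i < size h) av h`_i.
Definition zetaG : BPt := Some gaussNorm.

Definition leB (x y : BPt) : Prop :=
  match y with
  | None => True
  | Some t => match x with
              | None => False
              | Some s => forall h, Rle (s h) (t h)
              end
  end.

(* z lies on the path [x,y]: z is above x or y and below every common
   upper bound of x and y (i.e. [x,y] = [x, x v y] u [y, x v y]). *)
Definition onPath (z x y : BPt) : Prop :=
  isBerk z /\ (leB x z \/ leB y z) /\
  (forall w, isBerk w -> leB x w -> leB y w -> leB z w).

(* x v_G y : the first point where [x,zeta_G] and [y,zeta_G] meet, i.e.
   the point z of their intersection with intersection = [z, zeta_G]. *)
Definition joinG (x y : BPt) : BPt :=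
  epsilon (inhabits None) (fun z =>
    onPath z x zetaG /\ onPath z y zetaG /\
    (forall w, onPath w x zetaG -> onPath w y zetaG -> onPath w z zetaG)).

Definition is_glb (S : R -> Prop) (m : R) : Prop :=
  (forall r, S r -> Rle m r) /\ (forall m', (forall r, S r -> Rle m' r) -> Rle m' m).

Definition Rinf (S : R -> Prop) : R := epsilon (inhabits R0) (is_glb S).

(* diam_infinity(x) = inf_a [T - a]_x  (= r for zeta_{a,r}, 0 at type I) *)
Definition diamInf (s : seminorm) : R :=
  Rinf (fun r => exists a : K, r = s ('X - a%:P)).

(* diam_G(x) = q^{-rho(zeta_G,x)}; explicitly diam_G(zeta_{a,r}) =
   r / max(1,|a|,r)^2 = diam_inf(x) / max(1,[T]_x)^2, and 0 on P^1(K). *)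
Definition diamG (x : BPt) : R :=
  match x with
  | None => R0
  | Some s => Rdiv (diamInf s) (Rmult (Rmax R1 (s 'X)) (Rmax R1 (s 'X)))
  end.

Definition dFRL (x y : BPt) : R :=
  Rminus (Rminus (Rplus (diamG (joinG x y)) (diamG (joinG x y))) (diamG x)) (diamG y).

Definition homcomp (f g h : {poly K}) : {poly K} :=
  let n := (size h).-1 in \sum_(i < size h) h`_i *: (f ^+ i * g ^+ (subn n i)).

(* Berkovich action of phi = [F:G]:  [h]_{phi(x)} = [h o phi]_x *)
Definition phiB (d : nat) (f g : {poly K}) (x : BPt) : BPt :=
  match x with
  | None => if g`_d != 0 then Some (evalSemi (f`_d / g`_d)) else None
  | Some s =>
      if Req_EM_T (s g) R0 then None
      else Some (fun h => Rdiv (s (homcomp f g h)) (pow (s g) (size h).-1))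
  end.

End Defs.

(* Main.v *)
Require Import Defs.
From Stdlib Require Import Reals Lra ClassicalEpsilon.
From HB Require Import structures.
From mathcomp Require Import all_boot all_order all_algebra.
From mathcomp Require Import polyXY.

(** A point [x] of the Berkovich line is recorded by the function
    [sdist x p = diamG (x v_G p)] of [p] in P^1(K). For points [z] of the path
    [[x, zeta_G]] this function is [max (sdist x, c)] for a constant [c], and
    [diamG (x v_G y)] is the infimum over [p] of [max (sdist x p, sdist y p)].

    Cramer's rule for the Sylvester matrix gives [max (|F|, |G|) >= |Res|] at
    every point of norm one. If [q = phi p] then the form [q2 F - q1 G], for a
    unit vector [(q1, q2)], is integral and vanishes at [p]; hence
    [sdist (phi x) (phi p) <= sdist x p / |Res|] for all [x]. Taking [x] of
    type I this is the first inequality; in general it yields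
    [diamG (phi x v_G phi y) <= diamG (x v_G y) / |Res|].

    On the other hand a form of degree [d] splits into [d] linear forms, so
    [phi] stretches logarithmic lengths on a path towards [zeta_G] by at most
    [d]. As [d(x, y)] is the length of the path from [x] to [y] for the
    logarithmic metric weighted by [diamG], the two facts give
    [d(phi x, phi y) <= (d / |Res|) d(x, y)], which is stronger than the second
    inequality. *)

Set Implicit Arguments.
Unset Strict Implicit.
Unset Printing Implicit Defensive.

Import GRing.Theory.

Delimit Scope ring_scope with ring.
Local Open Scope R_scope.

(** * Elementary real inequalities and finite maxima *)

Lemma le_all_eps (x y : R) : (forall e, 0 < e -> x <= y + e) -> x <= y.
Proof.
move=> h; case: (Rle_or_lt x y) => // lt_yx.
have := h ((x - y) / 2); lra.
Qed.

Lemma div_ge0 (a b : R) : 0 <= a -> 0 < b -> 0 <= a / b.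
Proof. by move=> ha hb; apply: Rmult_le_pos => //; apply/Rlt_le/Rinv_0_lt_compat. Qed.

Lemma div_le_of_le_mul (a b c : R) : 0 < b -> a <= c * b -> a / b <= c.
Proof.
move=> hb h; apply: (Rmult_le_reg_r b) => //.
by rewrite /Rdiv Rmult_assoc Rinv_l ?Rmult_1_r //; lra.
Qed.

Lemma le_div_of_mul_le (a b c : R) : 0 < b -> c * b <= a -> c <= a / b.
Proof.
move=> hb h; apply: (Rmult_le_reg_r b) => //.
by rewrite /Rdiv Rmult_assoc Rinv_l ?Rmult_1_r //; lra.
Qed.

Lemma Rdiv_mulK (a b : R) : b <> 0 -> a / b * b = a.
Proof. by move=> h; field. Qed.

Lemma le_mul_of_div_le (a b c : R) : 0 < b -> a / b <= c -> a <= c * b.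
Proof.
move=> hb h; have := Rmult_le_compat_r _ _ _ (Rlt_le _ _ hb) h.
by rewrite Rdiv_mulK //; lra.
Qed.

Lemma Rmax_div (a b c : R) : 0 < c -> Rmax a b / c = Rmax (a / c) (b / c).
Proof.
move=> hc; rewrite /Rdiv ![_ * / c]Rmult_comm RmaxRmult //.
by apply/Rlt_le/Rinv_0_lt_compat.
Qed.

Lemma Rmax_1_div (a b : R) : 0 < b -> Rmax 1 (a / b) = Rmax a b / b.
Proof. by move=> hb; rewrite Rmax_div // Rmax_comm; congr Rmax; field; lra. Qed.

Lemma Rle_max_compat (a b c d : R) : a <= c -> b <= d -> Rmax a b <= Rmax c d.
Proof.
by move=> h1 h2; apply: Rmax_lub; [apply: Rle_trans h1 (Rmax_l _ _) | apply: Rle_trans h2 (Rmax_r _ _)].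
Qed.

Lemma Rmax_spec (a b : R) : (b <= a /\ Rmax a b = a) \/ (a <= b /\ Rmax a b = b).
Proof.
by case: (Rle_or_lt a b) => h; [right; rewrite Rmax_right | left; rewrite Rmax_left]; lra.
Qed.

(** Only maxima in the goal are split, so hypotheses are moved there before a call. Innermost maxima
    go first, which leaves [lra] with linear cases. *)
Ltac rmax_lra :=
  repeat match goal with |- context [Rmax ?a ?b] =>
    lazymatch constr:((a, b)) with context [Rmax _ _] => fail | _ => idtac end;
    let e := fresh "e" in
    destruct (Rmax_spec a b) as [[? e] | [? e]]; rewrite ?e; clear e
  end; intros; lra.

Lemma Rmax_ge0_l (a b : R) : 0 <= a -> 0 <= Rmax a b.
Proof. by move=> h; apply: Rle_trans h (Rmax_l _ _). Qed.

(* Growth [q^(2n) >= (n e)^2] with [q = 1 + e] beats the linear factor. *)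
Lemma le_of_pow_le_linear (t m : R) :
  0 <= t -> 0 <= m -> (forall n, t ^ n <= INR n.+1 * m ^ n) -> t <= m.
Proof.
move=> t0 m0 h; case: (Rle_or_lt t m) => // lt_mt.
case: (Req_dec m 0) => [me|mn].
  by have := h 1%N; rewrite me /=; lra.
have mp : 0 < m by lra.
set q := t / m; set e := q - 1.
have ep : 0 < e.
  have : 1 < q by apply: (Rmult_lt_reg_r m) => //; rewrite /q /Rdiv Rmult_assoc Rinv_l; lra.
  by rewrite /e; lra.
have hq n : q ^ n <= INR n.+1.
  rewrite /q /Rdiv Rpow_mult_distr pow_inv.
  by apply: div_le_of_le_mul; [exact: pow_lt | exact: h].
have hb n : 1 + INR n * e <= q ^ n.
  by have := Rfunctions.poly n e ep; rewrite /e; replace (1 + (q - 1)) with q by ring.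
(* For this [N], [(1 + N e)^2 <= q^(2N) <= 2N + 1], while [N^2 e^2 > 3N >= 2N + 1]. *)
have [N hN] := INR_unbounded (3 / (e * e)).
have hN1 : 3 < INR N * (e * e).
  have ee : 0 < e * e by nra.
  have := Rmult_lt_compat_r _ _ _ ee hN.
  by rewrite /Rdiv Rmult_assoc Rinv_l ?Rmult_1_r //; lra.
have N1 : 1 <= INR N.
  case: (N) hN1 => [|k] hk; last by rewrite S_INR; have := pos_INR k; lra.
  by rewrite /= in hk; lra.
have h1 := hb N; have h2 := hq (N + N)%N.
have e2 : q ^ (N + N)%N = q ^ N * q ^ N by rewrite -pow_add.
have e3 : INR (N + N).+1 = INR N + INR N + 1 by rewrite S_INR plus_INR.
have : 0 <= INR N * e by nra.
move: h1 h2; rewrite e2 e3; nra.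
Qed.

Lemma bigmax_ge0 (I : Type) (s : seq I) (F : I -> R) :
  0 <= \big[Rmax/0]_(i <- s) F i.
Proof.
elim: s => [|i s IH]; first by rewrite big_nil; lra.
by rewrite big_cons; apply: Rle_trans IH (Rmax_r _ _).
Qed.

Lemma le_bigmax (I : eqType) (s : seq I) (F : I -> R) i :
  i \in s -> F i <= \big[Rmax/0]_(j <- s) F j.
Proof.
elim: s => // j s IH; rewrite inE big_cons => /orP[/eqP ->|/IH h].
  exact: Rmax_l.
by apply: Rle_trans h (Rmax_r _ _).
Qed.

Lemma bigmax_le (I : Type) (s : seq I) (F : I -> R) B :
  0 <= B -> (forall i, F i <= B) -> \big[Rmax/0]_(i <- s) F i <= B.
Proof.
move=> B0 h; elim: s => [|i s IH]; first by rewrite big_nil.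
by rewrite big_cons; apply: Rmax_lub.
Qed.

Lemma bigmax_attained (I : Type) (s : seq I) (F : I -> R) :
  (\big[Rmax/0]_(i <- s) F i = 0) \/ exists i, F i = \big[Rmax/0]_(i <- s) F i.
Proof.
elim: s => [|i s IH]; first by left; rewrite big_nil.
rewrite big_cons; case: (Rle_or_lt (F i) (\big[Rmax/0]_(j <- s) F j)) => h.
  by rewrite Rmax_right.
by right; exists i; rewrite Rmax_left //; lra.
Qed.

(** * Nonarchimedean valuations and Gauss norms *)

(** Nonzero elements may have value 0, as for the seminorm of a point of P^1(K). The ring is
    arbitrary because [thicken] takes a Gauss norm whose coefficients lie in [{poly K}], valued by a
    seminorm. *)
Definition na_val (A : comNzRingType) (v : A -> R) : Prop :=
  [/\ forall x, 0 <= v x, v 0%ring = 0, v 1%ring = 1,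
      forall x y, v (x * y)%ring = v x * v y
    & forall x y, v (x + y)%ring <= Rmax (v x) (v y)].

Section Val.
Variables (A : comNzRingType) (v : A -> R).
Hypothesis vP : na_val v.

Lemma nv_ge0 x : 0 <= v x. Proof. by case: vP. Qed.
Lemma nv0 : v 0%ring = 0. Proof. by case: vP. Qed.
Lemma nv1 : v 1%ring = 1. Proof. by case: vP. Qed.
Lemma nvM x y : v (x * y)%ring = v x * v y. Proof. by case: vP. Qed.
Lemma nvD x y : v (x + y)%ring <= Rmax (v x) (v y). Proof. by case: vP. Qed.

Lemma nvN x : v (- x)%ring = v x.
Proof.
have h : v (-1)%ring = 1.
  have : v (-1)%ring * v (-1)%ring = 1 by rewrite -nvM mulrNN mulr1 nv1.
  by have := nv_ge0 (-1)%ring; nra.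
by rewrite -mulN1r nvM h Rmult_1_l.
Qed.

Lemma nvB x y : v (x - y)%ring <= Rmax (v x) (v y).
Proof. by rewrite -(nvN y); apply: nvD. Qed.

Lemma nv_subC x y : v (x - y)%ring = v (y - x)%ring.
Proof. by rewrite -nvN opprB. Qed.

Lemma nvX x n : v (x ^+ n)%ring = v x ^ n.
Proof. by elim: n => [|n IH]; rewrite ?expr0 ?nv1 // exprS nvM IH. Qed.

Lemma nv_add_dom x y : v y < v x -> v (x + y)%ring = v x.
Proof.
move=> h; apply: Rle_antisym.
  by apply: Rle_trans (nvD x y) _; rewrite Rmax_left; lra.
have : v x <= Rmax (v (x + y)%ring) (v y).
  by rewrite -{1}(addrK y x); apply: nvB.
by rewrite /Rmax; case: Rle_dec => _; lra.
Qed.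

Lemma nv_sum (I : Type) (s : seq I) (P : pred I) (F : I -> A) B :
  0 <= B -> (forall i, P i -> v (F i) <= B) -> v (\sum_(i <- s | P i) F i)%ring <= B.
Proof.
move=> B0 h; elim/big_rec: _ => [|i x Pi IH]; first by rewrite nv0.
by apply: Rle_trans (nvD _ _) _; apply: Rmax_lub => //; apply: h.
Qed.

Lemma nv_sum_lt (I : Type) (s : seq I) (P : pred I) (F : I -> A) B :
  0 < B -> (forall i, P i -> v (F i) < B) -> v (\sum_(i <- s | P i) F i)%ring < B.
Proof.
move=> B0 h; elim/big_rec: _ => [|i x Pi IH]; first by rewrite nv0.
by apply: Rle_lt_trans (nvD _ _) _; apply: Rmax_lub_lt => //; apply: h.
Qed.

Lemma nv_nat n : v (n%:R)%ring <= 1.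
Proof.
elim: n => [|n IH]; first by rewrite nv0; lra.
rewrite -addn1 natrD; apply: Rle_trans (nvD _ _) _.
by rewrite nv1; apply: Rmax_lub; lra.
Qed.

Definition gauss (r : R) (p : {poly A}) : R :=
  \big[Rmax/0]_(i < size p) (v p`_i * r ^ i).

Variable r : R.
Hypothesis r0 : 0 < r.

Lemma gauss_ge0 p : 0 <= gauss r p.
Proof. exact: bigmax_ge0. Qed.

Lemma gauss_term_ge0 (p : {poly A}) i : 0 <= v (p`_i)%ring * r ^ i.
Proof. by apply: Rmult_le_pos; [exact: nv_ge0 | apply/Rlt_le/pow_lt]. Qed.

Lemma gauss_coef (p : {poly A}) i : v (p`_i)%ring * r ^ i <= gauss r p.
Proof.
case: (ltnP i (size p)) => hi; last first.
  by rewrite nth_default // nv0 Rmult_0_l; apply: gauss_ge0.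
exact: (@le_bigmax _ _ (fun j : 'I_(size p) => v (p`_j)%ring * r ^ j) (Ordinal hi) (mem_index_enum _)).
Qed.

Lemma gauss_le (p : {poly A}) B : 0 <= B -> (forall i, v (p`_i)%ring * r ^ i <= B) -> gauss r p <= B.
Proof. by move=> B0 h; apply: bigmax_le. Qed.

Lemma gauss_first (p : {poly A}) : 0 < gauss r p ->
  exists i, v (p`_i)%ring * r ^ i = gauss r p /\
    forall j, (j < i)%N -> v (p`_j)%ring * r ^ j < gauss r p.
Proof.
move=> gp.
have [n hn] : exists n, v (p`_n)%ring * r ^ n = gauss r p.
  rewrite /gauss in gp *.
  case: (bigmax_attained (index_enum 'I_(size p)) (fun i : 'I_(size p) => v (p`_i)%ring * r ^ i)) => [e|[i hi]].
    by rewrite e in gp; lra.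
  by exists i.
elim/ltn_ind: n hn => n IH hn.
case: (classic (exists2 j, (j < n)%N & v (p`_j)%ring * r ^ j = gauss r p)) => [[j hj ej]|H].
  exact: (IH j).
exists n; split=> // j hj.
case: (Rle_lt_or_eq_dec _ _ (gauss_coef p j)) => // e.
by case: H; exists j.
Qed.

(** Gauss's lemma. For [>=], take the least indices [i] and [j] at which the two maxima are
    attained: in the coefficient of index [i + j] the term [p_i q_j] strictly dominates all
    others. *)
Lemma gaussM (p q : {poly A}) : gauss r (p * q)%ring = gauss r p * gauss r q.
Proof.
have gp := gauss_ge0 p; have gq := gauss_ge0 q.
have rk k : 0 < r ^ k by apply: pow_lt.
have term i k : (i <= k)%N -> v (p`_i * q`_(k - i))%ring * r ^ k =
    (v (p`_i)%ring * r ^ i) * (v (q`_(k - i))%ring * r ^ (k - i)%N).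
  move=> ik; rewrite nvM -{2}(subnKC ik) pow_add; ring.
apply: Rle_antisym.
  apply: gauss_le => [|k]; first exact: Rmult_le_pos.
  rewrite coefM.
  suff h : v (\sum_(j < k.+1) p`_j * q`_(k - j))%ring <= gauss r p * gauss r q / r ^ k.
    apply: Rle_trans (Rmult_le_compat_r _ _ _ (Rlt_le _ _ (rk k)) h) _.
    by rewrite /Rdiv Rmult_assoc Rinv_l; [lra | have := rk k; lra].
  apply: nv_sum => [|i _]; first by apply: div_ge0 => //; apply: Rmult_le_pos.
  apply: le_div_of_mul_le => //; rewrite (term _ _ (ltnSE (ltn_ord i))).
  by apply: Rmult_le_compat; [exact: gauss_term_ge0 | exact: gauss_term_ge0
    | exact: gauss_coef | exact: gauss_coef].
case: (Req_dec (gauss r p) 0) => [->|np]; first by rewrite Rmult_0_l; apply: gauss_ge0.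
case: (Req_dec (gauss r q) 0) => [->|nq]; first by rewrite Rmult_0_r; apply: gauss_ge0.
have {np}gp' : 0 < gauss r p by lra.
have {nq}gq' : 0 < gauss r q by lra.
have [i [ei li]] := gauss_first gp'; have [j [ej lj]] := gauss_first gq'.
have iij : (i <= i + j)%N by rewrite leq_addr.
suff <- : v ((p * q)`_(i + j))%ring * r ^ (i + j)%N = gauss r p * gauss r q.
  exact: gauss_coef.
have tij := term i (i + j)%N iij; rewrite addKn ei ej in tij.
rewrite -tij; congr (_ * _).
rewrite coefM (bigD1 (Ordinal (leq_ltn_trans iij (ltnSn _)))) //= addKn.
apply: nv_add_dom.
have B0 : 0 < gauss r p * gauss r q by nra.
have -> : v (p`_i * q`_j)%ring = gauss r p * gauss r q / r ^ (i + j)%N.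
  by rewrite -tij /Rdiv Rmult_assoc Rinv_r ?Rmult_1_r //; have := rk (i + j)%N; lra.
apply: nv_sum_lt => [|[l hl] /= nl].
  by apply: Rdiv_lt_0_compat.
apply: (Rmult_lt_reg_r (r ^ (i + j)%N)) => //.
rewrite (term l (i + j)%N) // Rdiv_mulK; last by have := rk (i + j)%N; lra.
have gl := gauss_coef p l; have gl' := gauss_coef q (i + j - l)%N.
have p1 := gauss_term_ge0 p l; have p2 := gauss_term_ge0 q (i + j - l)%N.
(* Below [i] the first factor is strictly smaller; above [i] the other index drops below [j] and the
   second factor is. *)
case: (ltngtP l i) => [lt|gt|e].
- by have := li _ lt; nra.
- have lt : (i + j - l < j)%N by rewrite ltn_subLR // ltn_add2r.
  by have := lj _ lt; nra.
- by case/negP: nl; apply/eqP/val_inj.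
Qed.

Lemma gauss_na_val : na_val (gauss r).
Proof.
split.
- exact: gauss_ge0.
- by rewrite /gauss size_poly0 big_ord0.
- by rewrite /gauss size_poly1 big_ord_recl big_ord0 coef1 /= nv1 Rmult_1_r Rmax_left; lra.
- exact: gaussM.
- move=> p q; apply: gauss_le => [|i].
    by apply: Rle_trans (gauss_ge0 p) (Rmax_l _ _).
  rewrite coefD.
  have rk : 0 < r ^ i by apply: pow_lt.
  have := gauss_coef p i; have := gauss_coef q i.
  have h : v (p`_i + q`_i)%ring * r ^ i <= Rmax (v (p`_i)%ring * r ^ i) (v (q`_i)%ring * r ^ i).
    rewrite ![_ * r ^ i]Rmult_comm RmaxRmult; last by lra.
    by apply: Rmult_le_compat_l; [lra | exact: nvD].
  move=> hq hp; apply: Rle_trans h _.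
  exact: Rle_max_compat.
Qed.

Lemma gaussC c : gauss r c%:P = v c.
Proof.
apply: Rle_antisym.
  apply: gauss_le; [exact: nv_ge0 | move=> [|i]]; rewrite coefC /=; first by lra.
  by rewrite nv0; have := nv_ge0 c; lra.
by have := gauss_coef c%:P 0; rewrite coefC /=; lra.
Qed.

Lemma gauss_XaddC c : gauss r ('X + c%:P)%ring = Rmax r (v c).
Proof.
apply: Rle_antisym.
  apply: gauss_le; first by apply: Rle_trans (Rlt_le _ _ r0) (Rmax_l _ _).
  move=> [|[|i]]; rewrite coefD coefX coefC /= ?add0r ?addr0 ?nv1 ?nv0.
  - by have := Rmax_r r (v c); lra.
  - by have := Rmax_l r (v c); lra.
  - by have := Rmax_l r (v c); lra.
have h0 := gauss_coef ('X + c%:P)%ring 0; have h1 := gauss_coef ('X + c%:P)%ring 1.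
move: h0 h1; rewrite !coefD !coefX !coefC /= add0r addr0 nv1 => h0 h1.
by apply: Rmax_lub; lra.
Qed.

End Val.

(** * Berkovich points as homogeneous seminorms *)

Section Seminorms.
Variables (K : closedFieldType) (av : K -> R).
Hypothesis avP : is_na_abs av.

Definition at_root (s : {poly K} -> R) (a : K) : R := s ('X - a%:P)%ring.

Definition adist (a b : K) : R := av (a - b)%ring.

Lemma at_root0 s : at_root s 0%ring = s 'X%ring.
Proof. by rewrite /at_root subr0. Qed.

Lemma av_na_val : na_val av.
Proof.
case: avP => h0 [hz [hM hD]]; split=> //; first exact/hz.
have e : av 1%ring * av 1%ring = av 1%ring by rewrite -hM mulr1.
have n1 : av 1%ring <> 0 by move/hz/eqP; rewrite oner_eq0.
by apply: (Rmult_eq_reg_r (av 1%ring)); rewrite ?Rmult_1_l.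
Qed.

Lemma av_eq0 x : av x = 0 -> x = 0%ring.
Proof. by case: avP => _ [hz _] /hz. Qed.

Lemma av_gt0 x : x != 0%ring -> 0 < av x.
Proof.
move=> /eqP nx; have := nv_ge0 av_na_val x.
by case/Rle_lt_or_eq_dec => // e; case: nx; apply: av_eq0.
Qed.

Lemma avV x : x != 0%ring -> av (x^-1)%ring = / av x.
Proof.
move=> nx; have p := av_gt0 nx.
apply: (Rmult_eq_reg_r (av x)); last by lra.
by rewrite -(nvM av_na_val) mulVf // (nv1 av_na_val) Rinv_l //; lra.
Qed.

Lemma av_div x y : y != 0%ring -> av (x / y)%ring = av x / av y.
Proof. by move=> ny; rewrite (nvM av_na_val) avV. Qed.

Section OneSeminorm.
Variable s : {poly K} -> R.
Hypothesis sP : is_mult_seminorm av s.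

Lemma semi_sum_le n (F : 'I_n -> {poly K}) B :
  (forall i, s (F i) <= B) -> s (\sum_i F i)%ring <= INR n * B.
Proof.
case: sP => s0 sM sD sC.
elim: n F => [|n IH] F h; first by rewrite big_ord0 -(polyC0 K) sC (nv0 av_na_val) /=; lra.
rewrite big_ord_recr S_INR /=; apply: Rle_trans (sD _ _) _.
rewrite Rmult_plus_distr_r Rmult_1_l.
by apply: Rplus_le_compat; [apply: IH => i; apply: h | apply: h].
Qed.

(** The ordinary triangle inequality becomes ultrametric: the binomial expansion of [(a + b)^n] has
    [n + 1] terms with integer coefficients of value at most 1, so [s (a + b)^n <= (n + 1) m^n] for
    all [n]. *)
Lemma semi_na_val : na_val s.
Proof.
case: (sP) => s0 sM sD sC; have avV := av_na_val.
have s1 : s 1%ring = 1 by rewrite -(polyC1 K) sC (nv1 avV).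
have sX h n : s (h ^+ n)%ring = s h ^ n.
  by elim: n => [|n IH]; rewrite ?expr0 // exprS sM IH.
split=> //; first by rewrite -(polyC0 K) sC (nv0 avV).
move=> a b; set m := Rmax _ _.
have m0 : 0 <= m by apply: Rmax_ge0_l.
apply: le_of_pow_le_linear => // n.
rewrite -sX exprDn; apply: semi_sum_le => i.
rewrite -mulr_natl -polyC_natr !sM sC !sX.
have e : m ^ n = 1 * (m ^ (n - i)%N * m ^ i) by rewrite Rmult_1_l -pow_add plusE subnK // -ltnS.
rewrite e.
have P1 : 0 <= s a ^ (n - i) by apply: pow_le.
have P2 : 0 <= s b ^ i by apply: pow_le.
apply: Rmult_le_compat; [exact: nv_ge0 | exact: Rmult_le_pos | exact: nv_nat |].
apply: Rmult_le_compat => //; apply: pow_incr; split=> //; [exact: Rmax_l | exact: Rmax_r].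
Qed.

Lemma semiC c : s (c%:P)%ring = av c.
Proof. by case: sP. Qed.

Lemma semiZ c h : s (c *: h)%ring = av c * s h.
Proof. by rewrite -mul_polyC (nvM semi_na_val) semiC. Qed.

Lemma semi_root_sub a b : at_root s a <= Rmax (at_root s b) (adist a b).
Proof.
rewrite /at_root /adist.
have -> : ('X - a%:P = ('X - b%:P) - (a - b)%:P :> {poly K})%ring.
  by rewrite polyCB opprB addrA subrK.
by rewrite -semiC; apply: (nvB semi_na_val).
Qed.

Lemma adist_le a b : adist a b <= Rmax (at_root s a) (at_root s b).
Proof.
rewrite /adist -semiC Rmax_comm.
have -> : ((a - b)%:P = ('X - b%:P) - ('X - a%:P) :> {poly K})%ring.
  by rewrite polyCB opprB [RHS]addrC addrA subrK.
exact: (nvB semi_na_val).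
Qed.

Lemma semi_root_le a : at_root s a <= Rmax (s 'X%ring) (av a).
Proof. by have := semi_root_sub a 0; rewrite at_root0 /adist !subr0. Qed.

Lemma av_le_root a : av a <= Rmax (s 'X%ring) (at_root s a).
Proof. by have := adist_le a 0; rewrite at_root0 /adist !subr0 Rmax_comm. Qed.

Lemma semiX_le_root a : s 'X%ring <= Rmax (at_root s a) (av a).
Proof. by have := semi_root_sub 0 a; rewrite at_root0 /adist sub0r (nvN av_na_val). Qed.

End OneSeminorm.

Lemma na_val_semi (s : {poly K} -> R) : na_val s -> (forall c, s (c%:P)%ring = av c) -> is_mult_seminorm av s.
Proof.
move=> sP sC; split=> //; [exact: nv_ge0 | exact: nvM |].
move=> h1 h2; apply: Rle_trans (nvD sP _ _) _.
have := nv_ge0 sP h1; have := nv_ge0 sP h2.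
by move=> ? ?; apply: Rmax_lub; lra.
Qed.

(** As [K] is algebraically closed, every polynomial is a constant times a product of factors
    ['X - b]. *)
Lemma semi_le_of_roots (s t : {poly K} -> R) : is_mult_seminorm av s -> is_mult_seminorm av t ->
  (forall b, at_root s b <= at_root t b) -> forall h, s h <= t h.
Proof.
move=> sP tP le_st h; have [r ->] := closed_field_poly_normal h.
rewrite (semiZ sP) (semiZ tP).
apply: Rmult_le_compat_l; first exact: nv_ge0 av_na_val _.
elim: r => [|b r IH].
  by rewrite big_nil (nv1 (semi_na_val sP)) (nv1 (semi_na_val tP)); lra.
rewrite big_cons (nvM (semi_na_val sP)) (nvM (semi_na_val tP)).
by apply: Rmult_le_compat; [exact: (nv_ge0 (semi_na_val sP)) | exact: (nv_ge0 (semi_na_val sP))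
  | exact: le_st | exact: IH].
Qed.

(** The point [zeta_{0,r}]. *)
Definition ball_semi (r : R) : {poly K} -> R := gauss av r.

Lemma ball_semi_mult r : 0 < r -> is_mult_seminorm av (ball_semi r).
Proof.
move=> r0; apply: na_val_semi; first exact: gauss_na_val av_na_val _ r0.
exact: gaussC av_na_val _.
Qed.

Lemma ball_semi_root r b : 0 < r -> at_root (ball_semi r) b = Rmax r (av b).
Proof.
by move=> r0; rewrite /at_root /ball_semi -polyCN (gauss_XaddC av_na_val r0) (nvN av_na_val).
Qed.

Lemma gaussNormE h : gaussNorm av h = ball_semi 1 h.
Proof. by apply: eq_bigr => i _; rewrite pow1 Rmult_1_r. Qed.

(* The Gauss norm of [h(X + T)] in [T]: [zeta_{a,t}] becomes [zeta_{a,max(t,r)}]. *)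
Definition thicken (s : {poly K} -> R) (r : R) (h : {poly K}) : R := gauss s r (poly_XaY h).

Lemma thicken_mult (s : {poly K} -> R) r : is_mult_seminorm av s -> 0 < r -> is_mult_seminorm av (thicken s r).
Proof.
move=> sP r0; have sV := semi_na_val sP; have [g0 g00 g1 gM gD] := gauss_na_val sV r0.
apply: na_val_semi; first split; rewrite /thicken.
- by move=> h; apply: g0.
- by rewrite /poly_XaY rmorph0 comp_poly0.
- by rewrite /poly_XaY rmorph1 comp_polyC.
- by move=> h1 h2; rewrite /poly_XaY rmorphM comp_polyM gM.
- by move=> h1 h2; rewrite /poly_XaY rmorphD comp_polyD.
- by move=> c; rewrite /poly_XaY map_polyC comp_polyC (gaussC sV) // semiC.
Qed.

Lemma thicken_root (s : {poly K} -> R) r b : is_mult_seminorm av s -> 0 < r ->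
  at_root (thicken s r) b = Rmax r (at_root s b).
Proof.
move=> sP r0; rewrite /at_root /thicken /poly_XaY rmorphB /= map_polyX map_polyC comp_polyB comp_polyX comp_polyC.
by rewrite -addrA -polyCB (gauss_XaddC (semi_na_val sP)).
Qed.

(** * Norms of binary forms and the distance to a point of P^1(K) *)

Definition msup (s : {poly K} -> R) : R := Rmax 1 (s 'X%ring).

Lemma msup_ge1 s : 1 <= msup s.
Proof. exact: Rmax_l. Qed.

Lemma msup_gt0 s : 0 < msup s.
Proof. by have := msup_ge1 s; lra. Qed.

(* The seminorm of [h] viewed as a form of degree [n], normalised so that
   [max ([X], [Y]) = 1]; this treats infinity like any other point. *)
Definition hnorm (x : BPt K) (n : nat) (h : {poly K}) : R :=
  match x with Some s => s h / msup s ^ n | None => av (h`_n)%ring end.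

Lemma hnorm_Some s n h : hnorm (Some s) n h = s h / msup s ^ n.
Proof. by []. Qed.

Definition vec (p : P1K K) : K * K := if p is Some a then (a, 1%ring) else (1%ring, 0%ring).

(** A form whose zeros are the preimages of [p] under [[f : g]]; for the identity map it is the
    linear form [lform p] vanishing at [p]. *)
Definition pform (f g : {poly K}) (p : P1K K) : {poly K} :=
  ((vec p).2 *: f - (vec p).1 *: g)%ring.

Definition ht (p : P1K K) : R := Rmax (av (vec p).1) (av (vec p).2).

Definition lform (p : P1K K) : {poly K} := pform 'X 1 p.

(* Equals [diamG (joinG x p)]. *)
Definition sdist (x : BPt K) (p : P1K K) : R := hnorm x 1 (lform p) / ht p.

Lemma htE p : ht p = if p is Some a then Rmax 1 (av a) else 1.
Proof.
by case: p => [a|]; rewrite /ht /= (nv1 av_na_val) ?(nv0 av_na_val) 1?Rmax_comm // Rmax_right //; lra.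
Qed.

Lemma ht_ge1 p : 1 <= ht p.
Proof. by rewrite htE; case: p => [a|]; [exact: Rmax_l | lra]. Qed.

Lemma ht_gt0 p : 0 < ht p.
Proof. by have := ht_ge1 p; lra. Qed.

Lemma lformE p : lform p = if p is Some a then ('X - a%:P)%ring else (-1)%ring.
Proof.
case: p => [a|]; rewrite /lform /pform /=; first by rewrite scale1r alg_polyC.
by rewrite scale0r scale1r sub0r.
Qed.

Lemma size_lform p : (size (lform p) <= 2)%N.
Proof.
rewrite lformE; case: p => [a|]; first by rewrite size_XsubC.
by rewrite size_polyN size_poly1.
Qed.

(** Here [h] stands for a form of degree [n + 1]. If its dehomogenization has smaller degree, then Y
    divides it and the factor belongs to infinity, whose [lform] is the constant -1; otherwise a
    root exists. *)
Lemma linear_factor n (h : {poly K}) : (size h <= n.+2)%N ->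
  exists p (k : {poly K}), (size k <= n.+1)%N /\ h = (lform p * k)%ring.
Proof.
move=> sh; case: (leqP (size h) n.+1) => sh1.
  exists None, (- h)%ring; rewrite size_polyN; split=> //.
  by rewrite lformE mulN1r opprK.
have [a /factor_theorem [k hk]] : exists a, root h a.
  by apply/closed_rootP; case: (size h) sh1 => [|[|m]].
exists (Some a), k; rewrite lformE mulrC -hk; split=> //.
move: sh; rewrite hk; case: (eqVneq k 0%ring) => [->|nk]; first by rewrite size_poly0.
by rewrite size_Mmonic ?monicXsubC // size_XsubC addn2.
Qed.

Section OnePoint.
Variable x : BPt K.
Hypothesis xP : isBerk av x.

Lemma hnorm_ge0 n h : 0 <= hnorm x n h.
Proof.
case: x xP => [s|] /= sP; last exact: nv_ge0 av_na_val _.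
apply: div_ge0; first exact: nv_ge0 (semi_na_val sP) _.
exact/pow_lt/msup_gt0.
Qed.

Lemma hnormD n h1 h2 : hnorm x n (h1 + h2)%ring <= Rmax (hnorm x n h1) (hnorm x n h2).
Proof.
case: x xP => [s|] /= sP; last by rewrite coefD; apply: nvD av_na_val _ _.
have h := pow_lt _ n (msup_gt0 s).
rewrite -Rmax_div //; apply: Rmult_le_compat_r; first by apply/Rlt_le/Rinv_0_lt_compat.
exact: nvD (semi_na_val sP) _ _.
Qed.

Lemma hnormZ n c h : hnorm x n (c *: h)%ring = av c * hnorm x n h.
Proof.
case: x xP => [s|] /= sP; last by rewrite coefZ (nvM av_na_val).
by rewrite (semiZ sP) /Rdiv Rmult_assoc.
Qed.

Lemma hnormN n h : hnorm x n (- h)%ring = hnorm x n h.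
Proof. by rewrite -scaleN1r hnormZ (nvN av_na_val) (nv1 av_na_val) Rmult_1_l. Qed.

Lemma hnormB n h1 h2 : hnorm x n (h1 - h2)%ring <= Rmax (hnorm x n h1) (hnorm x n h2).
Proof. by rewrite -(hnormN _ h2); apply: hnormD. Qed.

(** The size bounds matter at infinity: they leave a single term in the coefficient of index [m + n]
    of the product. *)
Lemma hnormM m n (h1 h2 : {poly K}) : (size h1 <= m.+1)%N -> (size h2 <= n.+1)%N ->
  hnorm x (m + n) (h1 * h2)%ring = hnorm x m h1 * hnorm x n h2.
Proof.
case: x xP => [s|] /= sP s1 s2.
  rewrite (nvM (semi_na_val sP)) pow_add.
  have := pow_lt _ m (msup_gt0 s); have := pow_lt _ n (msup_gt0 s).
  by move=> ? ?; field; lra.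
rewrite -(nvM av_na_val); congr av.
have hm : (m < (m + n).+1)%N by rewrite ltnS leq_addr.
rewrite coefM (bigD1 (Ordinal hm)) //= addKn big1 ?addr0 // => -[i hi] /= ni.
case: (ltngtP i m) => [lt|gt|e].
- rewrite [X in (_ * X)%ring]nth_default ?mulr0 //; apply: leq_trans s2 _.
  by rewrite ltn_subRL ltn_add2r.
- by rewrite nth_default ?mul0r //; apply: leq_trans s1 gt.
- by case/negP: ni; apply/eqP/val_inj.
Qed.

Lemma hnorm_le n (h : {poly K}) C : (size h <= n.+1)%N -> 0 <= C ->
  (forall i, av (h`_i)%ring <= C) -> hnorm x n h <= C.
Proof.
case: x xP => [s|] /= sP sh C0 hC; last exact: hC.
apply: div_le_of_le_mul; first exact/pow_lt/msup_gt0.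
rewrite -(coefK h) poly_def; apply: (nv_sum (semi_na_val sP)) => [|i _].
  by apply: Rmult_le_pos => //; apply/Rlt_le/pow_lt/msup_gt0.
rewrite (semiZ sP) (nvX (semi_na_val sP)).
apply: Rmult_le_compat; [exact: nv_ge0 av_na_val _ | | exact: hC |].
  exact/pow_le/(nv_ge0 (semi_na_val sP)).
apply: (Rle_trans _ (msup s ^ i)).
  by apply: pow_incr; split; [exact: (nv_ge0 (semi_na_val sP)) | exact: Rmax_r].
by apply: Rle_pow; [exact: msup_ge1 | apply/leP; rewrite -ltnS (leq_trans _ sh)].
Qed.

Lemma hnorm_basis : Rmax (hnorm x 1 'X%ring) (hnorm x 1 1%ring) = 1.
Proof.
case: x xP => [s|] /= sP.
  rewrite -Rmax_div ?(nv1 (semi_na_val sP)) Rmult_1_r ?(Rmax_comm _ 1); last exact: msup_gt0.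
  by rewrite -/(msup s) /Rdiv Rinv_r //; have := msup_gt0 s; lra.
by rewrite coefX coef1 /= (nv1 av_na_val) (nv0 av_na_val) Rmax_left; lra.
Qed.

Lemma hnormX_le1 : hnorm x 1 'X%ring <= 1.
Proof. by rewrite -hnorm_basis; apply: Rmax_l. Qed.

Lemma hnorm1_le1 : hnorm x 1 1%ring <= 1.
Proof. by rewrite -hnorm_basis; apply: Rmax_r. Qed.

Lemma hnorm_deg0 (h : {poly K}) : (size h <= 1)%N -> hnorm x 0 h = av (h`_0)%ring.
Proof.
move=> sh; case: x xP => [s|] //= sP.
by rewrite {1}(size1_polyC sh) (semiC sP) /Rdiv Rinv_1 Rmult_1_r.
Qed.

Lemma hnorm_lform p : hnorm x 1 (lform p) = ht p * sdist x p.
Proof. by rewrite /sdist Rmult_comm Rdiv_mulK //; have := ht_gt0 p; lra. Qed.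

Lemma sdist_ge0 p : 0 <= sdist x p.
Proof. by apply: div_ge0; [exact: hnorm_ge0 | exact: ht_gt0]. Qed.

Lemma sdist_le1 p : sdist x p <= 1.
Proof.
apply: div_le_of_le_mul; first exact: ht_gt0.
rewrite Rmult_1_l; apply: Rle_trans (hnormB _ _ _) _; rewrite !hnormZ.
have hX := hnormX_le1; have h1 := hnorm1_le1.
have a1 := nv_ge0 av_na_val (vec p).1; have a2 := nv_ge0 av_na_val (vec p).2.
have m1 := Rmax_l (av (vec p).1) (av (vec p).2).
have m2 := Rmax_r (av (vec p).1) (av (vec p).2).
by rewrite /ht; apply: Rmax_lub; nra.
Qed.

Definition pdet (p q : P1K K) : K := ((vec p).2 * (vec q).1 - (vec p).1 * (vec q).2)%ring.

(** This and [pform_cramer2] eliminate [f] and [g] in turn. For ['X] and [1] they write [pdet p q]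
    times Y, respectively X, as a combination of the linear forms of [p] and [q]. *)
Lemma pform_cramer1 (f g : {poly K}) p q :
  ((vec q).2 *: pform f g p - (vec p).2 *: pform f g q = pdet p q *: g)%ring.
Proof.
rewrite /pform /pdet !scalerBr !scalerA [((vec q).2 * (vec p).2)%ring]mulrC.
by rewrite opprB addrC addrA subrK -scalerBl [((vec q).2 * _)%ring]mulrC.
Qed.

Lemma pform_cramer2 (f g : {poly K}) p q :
  ((vec q).1 *: pform f g p - (vec p).1 *: pform f g q = pdet p q *: f)%ring.
Proof.
rewrite /pform /pdet !scalerBr !scalerA [((vec q).1 * (vec p).1)%ring]mulrC.
by rewrite opprB addrA subrK -scalerBl [((vec q).1 * _)%ring]mulrC.
Qed.

Lemma sphE p q : sph av p q = av (pdet p q) / (ht p * ht q).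
Proof.
have avV := av_na_val; rewrite !htE /pdet; case: p q => [a|] [b|] /=.
- by rewrite mul1r mulr1 nv_subC.
- by rewrite mul1r mulr0 subr0 nv1 // Rmult_1_r.
- by rewrite mul0r mulr1 sub0r nvN // nv1 // Rmult_1_l.
- by rewrite mul0r mulr0 subr0 nv0 // /Rdiv Rmult_0_l.
Qed.

(** One of X and Y has norm 1 at [x], and its multiple by [pdet p q] is a combination of the two
    linear forms. Together with [sdist_le_sph] this is the ultrametric inequality for [x], [p],
    [q]. *)
Lemma sph_le_sdist p q : sph av p q <= Rmax (sdist x p) (sdist x q).
Proof.
rewrite sphE; have hp := ht_gt0 p; have hq := ht_gt0 q.
apply: div_le_of_le_mul; first by nra.
have sp := sdist_ge0 p; have sq := sdist_ge0 q.
set M := Rmax (sdist x p) _; have Mp := Rmax_l (sdist x p) (sdist x q).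
have Mq := Rmax_r (sdist x p) (sdist x q); rewrite -/M in Mp Mq.
have bound a b : av a <= ht q -> av b <= ht p ->
    hnorm x 1 (a *: lform p - b *: lform q)%ring <= M * (ht p * ht q).
  move=> ha hb; apply: Rle_trans (hnormB _ _ _) _; rewrite !hnormZ !hnorm_lform.
  have a0 := nv_ge0 av_na_val a; have b0 := nv_ge0 av_na_val b.
  have P : 0 < ht p * ht q by nra.
  have Q1 : ht p * ht q * sdist x p <= ht p * ht q * M by apply: Rmult_le_compat_l; lra.
  have Q2 : ht p * ht q * sdist x q <= ht p * ht q * M by apply: Rmult_le_compat_l; lra.
  have S1 : 0 <= ht p * sdist x p by nra.
  have S2 : 0 <= ht q * sdist x q by nra.
  by apply: Rmax_lub; nra.
have := hnorm_basis; rewrite {1}/Rmax; case: Rle_dec => _ e.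
  have := bound (vec q).2 (vec p).2 (Rmax_r _ _) (Rmax_r _ _).
  by rewrite pform_cramer1 hnormZ e Rmult_1_r.
have := bound (vec q).1 (vec p).1 (Rmax_l _ _) (Rmax_l _ _).
by rewrite pform_cramer2 hnormZ e Rmult_1_r.
Qed.

(** The same identities are solved for [lform p], using the one in which its coefficient is the
    larger coordinate of [q], of absolute value [ht q]. *)
Lemma sdist_le_sph p q : sdist x p <= Rmax (sdist x q) (sph av p q).
Proof.
have hp := ht_gt0 p; have hq := ht_gt0 q; have sp := sdist_ge0 p; have sq := sdist_ge0 q.
set M := Rmax _ _; have Mp := Rmax_l (sdist x q) (sph av p q).
have Mq := Rmax_r (sdist x q) (sph av p q); rewrite -/M in Mp Mq.
have {}Mq : av (pdet p q) <= M * (ht p * ht q).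
  by move: Mq; rewrite sphE; apply: le_mul_of_div_le; nra.
have key a b e : av a = ht q -> av b <= ht p -> hnorm x 1 e <= 1 ->
    (a *: lform p - b *: lform q = pdet p q *: e)%ring -> sdist x p <= M.
  move=> ha hb he eq.
  have : ht q * hnorm x 1 (lform p) <= M * (ht p * ht q).
    rewrite -ha -hnormZ.
    have -> : (a *: lform p = b *: lform q + pdet p q *: e)%ring by rewrite -eq addrC subrK.
    apply: Rle_trans (hnormD _ _ _) _; rewrite !hnormZ hnorm_lform ha.
    have b0 := nv_ge0 av_na_val b; have d0 := nv_ge0 av_na_val (pdet p q).
    have e0 := hnorm_ge0 1 e.
    have P : 0 < ht p * ht q by nra.
    have Q2 : ht p * ht q * sdist x q <= ht p * ht q * M by apply: Rmult_le_compat_l; lra.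
    have S2 : 0 <= ht q * sdist x q by nra.
    by apply: Rmax_lub; nra.
  by rewrite hnorm_lform => h; apply: (Rmult_le_reg_l (ht p * ht q)); nra.
case: (Rle_dec (av (vec q).1) (av (vec q).2)) => h.
  apply: (key (vec q).2 (vec p).2 1%ring); rewrite ?pform_cramer1 //.
  - by rewrite /ht Rmax_right.
  - exact: Rmax_r.
  - exact: hnorm1_le1.
apply: (key (vec q).1 (vec p).1 'X%ring); rewrite ?pform_cramer2 //.
- by rewrite /ht Rmax_left; lra.
- exact: Rmax_l.
- exact: hnormX_le1.
Qed.

End OnePoint.

(** A form of degree [n] is a product of [n] linear forms, and each contributes a factor [C]. This
    is where the degree of the map enters the stretching of logarithmic lengths. *)
Lemma hnorm_le_of_sdist u v C : isBerk av u -> isBerk av v -> 0 <= C ->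
  (forall p, sdist u p <= C * sdist v p) ->
  forall n (h : {poly K}), (size h <= n.+1)%N -> hnorm u n h <= C ^ n * hnorm v n h.
Proof.
move=> uP vP C0 hC; elim=> [|n IH] h sh.
  by rewrite !hnorm_deg0 //= Rmult_1_l; apply: Rle_refl.
have [p [k [sk ->]]] := linear_factor sh.
rewrite -[in hnorm u _ _]add1n -[in hnorm v _ _]add1n !hnormM ?size_lform // !hnorm_lform //.
apply: (Rle_trans _ (ht p * (C * sdist v p) * (C ^ n * hnorm v n k))); last by rewrite /=; lra.
have hp := ht_gt0 p; have := sdist_ge0 uP p; have := hnorm_ge0 uP n k.
move=> h1 h2; apply: Rmult_le_compat; [nra | by [] | | exact: IH].
by apply: Rmult_le_compat_l; [lra | exact: hC].
Qed.

Lemma sdistE x p : isBerk av x -> sdist x p =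
  match x, p with
  | Some s, Some a => at_root s a / (msup s * Rmax 1 (av a))
  | Some s, None => / msup s
  | None, Some a => / Rmax 1 (av a)
  | None, None => 0
  end.
Proof.
have avV := av_na_val; rewrite /sdist lformE htE.
have m1 a : 0 < Rmax 1 (av a) by have := Rmax_l 1 (av a); lra.
case: x p => [s|] [a|] /= xP.
- by rewrite -/(at_root s a); have := msup_gt0 s; have := m1 a => h1 h2; field; lra.
- rewrite (nvN (semi_na_val xP)) (nv1 (semi_na_val xP)).
  by have := msup_gt0 s => h; field; lra.
- rewrite coefB coefX coefC subr0 nv1 //.
  by rewrite /Rdiv Rmult_1_l.
- by rewrite coefN coef1 oppr0 nv0 // /Rdiv Rmult_0_l.
Qed.

End Seminorms.

(** * Paths to the Gauss point *)

Lemma Rinf_is_glb (S : R -> Prop) :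
  (exists r, S r) -> (forall r, S r -> 0 <= r) -> Defs.is_glb S (Rinf S).
Proof.
move=> [r0 Sr0] S0; apply: epsilon_spec.
have [||m [ub lub]] := completeness (fun r => S (- r)).
- by exists 0 => r /S0; lra.
- by exists (- r0); rewrite Ropp_involutive.
exists (- m); split.
  move=> r Sr; have : - r <= m by apply: ub; rewrite Ropp_involutive.
  by lra.
move=> m' hm'; suff : m <= - m' by lra.
by apply: lub => r /hm'; lra.
Qed.

Lemma is_glb_approx (S : R -> Prop) m : Defs.is_glb S m ->
  forall e, 0 < e -> exists2 r, S r & r < m + e.
Proof.
move=> [_ hm] e e0; case: (classic (exists2 r, S r & r < m + e)) => // H.
suff : m + e <= m by lra.
apply: hm => r Sr; case: (Rle_or_lt (m + e) r) => // lt.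
by case: H; exists r.
Qed.

Section Paths.
Variables (K : closedFieldType) (av : K -> R).
Hypothesis avP : is_na_abs av.

Notation sdist := (@sdist K av).
Notation diam := (@diamG K).
Notation berk := (isBerk av).

Section Diameter.
Variable s : {poly K} -> R.
Hypothesis sP : is_mult_seminorm av s.

Lemma diamInf_glb :
  Defs.is_glb (fun r => exists a, r = at_root s a) (diamInf s).
Proof.
apply: Rinf_is_glb; first by exists (at_root s 0%ring), 0%ring.
by move=> r [a ->]; apply: (nv_ge0 (semi_na_val avP sP)).
Qed.

Lemma diamInf_le a : diamInf s <= at_root s a.
Proof. by have [h _] := diamInf_glb; apply: h; exists a. Qed.

Lemma diamInf_ge0 : 0 <= diamInf s.
Proof.
by have [_ h] := diamInf_glb; apply: h => r [a ->]; apply: (nv_ge0 (semi_na_val avP sP)).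
Qed.

Lemma diamInf_le_X : diamInf s <= s 'X%ring.
Proof. by have := diamInf_le 0%ring; rewrite at_root0. Qed.

Lemma diamInf_le_msup : diamInf s <= msup s.
Proof. by apply: Rle_trans diamInf_le_X (Rmax_r _ _). Qed.

(** If [|a|] and [[T]], both raised to at least 1, differ, then [[T - a]] is as large as both. The
    dichotomy converts affine radii into spherical ones. *)
Lemma ht_msup_cases a :
  Rmax 1 (av a) = msup s \/
  (msup s <= at_root s a /\ Rmax 1 (av a) <= at_root s a).
Proof.
have h1 := semiX_le_root avP sP a; have h2 := av_le_root avP sP a; rewrite /msup.
case: (Rtotal_order (Rmax 1 (av a)) (Rmax 1 (s 'X%ring))) => [h|[h|h]]; [|by left|];
  by right; split; move: h1 h2 h; rmax_lra.
Qed.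

End Diameter.

(** With [diamG_approx] this makes [diam x] the infimum of [sdist x] over P^1(K). *)
Lemma diamG_le x p : berk x -> diam x <= sdist x p.
Proof.
move=> xP; case: x xP => [s|] sP; last first.
  by rewrite /=; apply: (sdist_ge0 avP (x := None)).
rewrite sdistE //=; have M1 := msup_gt0 s; have dM := diamInf_le_msup sP.
have d0 := diamInf_ge0 sP; rewrite -!/(msup s).
case: p => [a|]; last first.
  by apply: div_le_of_le_mul; [nra | rewrite -Rmult_assoc Rinv_l; lra].
have H1 : 0 < Rmax 1 (av a) by have := Rmax_l 1 (av a); lra.
have da := diamInf_le sP a.
apply: div_le_of_le_mul; first by nra.
have -> : at_root s a / (msup s * Rmax 1 (av a)) * (msup s * msup s) =
          at_root s a * msup s / Rmax 1 (av a) by field; lra.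
apply: le_div_of_mul_le => //.
case: (ht_msup_cases sP a) => [->|[h1 h2]]; first by apply: Rmult_le_compat_r; lra.
by rewrite Rmult_comm [_ * msup s]Rmult_comm; apply: (Rle_trans _ (at_root s a * msup s)); nra.
Qed.

Lemma diamG_approx x e : berk x -> 0 < e -> exists p, sdist x p < diam x + e.
Proof.
move=> xP e0; case: x xP => [s|] sP; last first.
  by exists None; rewrite sdistE //=; lra.
have M1 := msup_ge1 s; rewrite /= -!/(msup s).
have [r [a ->] ha] := is_glb_approx (diamInf_glb sP) e0.
have sa0 := nv_ge0 (semi_na_val avP sP) ('X - a%:P)%ring.
have MM : 1 <= msup s * msup s by nra.
have step : at_root s a / (msup s * msup s) < diamInf s / (msup s * msup s) + e.
  have h : e / (msup s * msup s) <= e by apply: div_le_of_le_mul; nra.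
  have : at_root s a / (msup s * msup s) < (diamInf s + e) / (msup s * msup s).
    by apply: Rmult_lt_compat_r => //; apply: Rinv_0_lt_compat; lra.
  by rewrite Rdiv_plus_distr; lra.
(* If [a] has height at least [msup s], it serves itself. Otherwise [at_root s a >= msup s], and
   infinity is as close. *)
case: (Rle_or_lt (msup s) (Rmax 1 (av a))) => hH.
  exists (Some a); rewrite sdistE //; apply: Rle_lt_trans step.
  apply: Rmult_le_compat_l => //; apply: Rinv_le_contravar; nra.
exists None; rewrite sdistE //; apply: Rle_lt_trans step.
apply: le_div_of_mul_le; first by lra.
rewrite -Rmult_assoc Rinv_l ?Rmult_1_l; last by lra.
by case: (ht_msup_cases sP a); lra.
Qed.

Lemma diamG_ge0 x : berk x -> 0 <= diam x.
Proof.
case: x => [s|] //= sP; last by lra.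
apply: div_ge0; first exact: diamInf_ge0.
exact: Rmult_lt_0_compat (msup_gt0 s) (msup_gt0 s).
Qed.

Lemma diamG_max z x c : berk z -> berk x ->
  (forall p, sdist z p = Rmax (sdist x p) c) -> diam z = Rmax (diam x) c.
Proof.
move=> zP xP h; apply: Rle_antisym; apply: le_all_eps => e e0.
  have [p hp] := diamG_approx xP e0; apply: Rle_trans (diamG_le p zP) _; rewrite h.
  have := Rmax_l (diam x) c; have := Rmax_r (diam x) c => ? ?.
  by apply: Rmax_lub; lra.
have [p hp] := diamG_approx zP e0; rewrite h in hp.
have := diamG_le p xP; have := Rmax_l (sdist x p) c; have := Rmax_r (sdist x p) c => ? ? ?.
by apply: Rmax_lub; lra.
Qed.

(** The comparison goes through [sph p q]. Consequently the distance functions of [x] and [y] agree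
    above the level [max (sdist x q, sdist y q)], for any [q]. *)
Lemma sdist_merge x y p q : berk x -> berk y ->
  sdist x p <= Rmax (sdist y p) (Rmax (sdist x q) (sdist y q)).
Proof.
move=> xP yP; have := sdist_le_sph avP xP p q; have := sph_le_sdist avP yP p q.
by rmax_lra.
Qed.

Lemma sdist_merge_eq x y p q c : berk x -> berk y -> sdist x q <= c -> sdist y q <= c ->
  Rmax (sdist x p) c = Rmax (sdist y p) c.
Proof.
move=> xP yP hx hy.
have := sdist_merge p q xP yP; have := sdist_merge p q yP xP.
by rmax_lra.
Qed.

(** Since [r <= msup s], enlarging the radius keeps [msup]. At [a] of height [msup s] the new term
    is exactly [r / msup^2]; at infinity and at all other [a] it is absorbed by
    [sdist (Some s) p]. *)
Lemma sdist_thick s u r p : is_mult_seminorm av s -> is_mult_seminorm av u ->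
  0 <= r <= msup s -> (forall b, at_root u b = Rmax r (at_root s b)) ->
  sdist (Some u) p = Rmax (sdist (Some s) p) (r / (msup s * msup s)).
Proof.
move=> sP uP [r0 rM] h; have M1 := msup_gt0 s.
have Mu : msup u = msup s.
  have := h 0%ring; rewrite !at_root0 /msup => ->; move: rM; rewrite /msup.
  by rmax_lra.
rewrite !sdistE // Mu; case: p => [a|]; last first.
  rewrite Rmax_left //; apply: div_le_of_le_mul; first by nra.
  by rewrite -Rmult_assoc Rinv_l; lra.
rewrite h; have H1 : 0 < Rmax 1 (av a) by have := Rmax_l 1 (av a); lra.
have MH : 0 < msup s * Rmax 1 (av a) by nra.
rewrite Rmax_div // Rmax_comm.
case: (ht_msup_cases sP a) => [->|[h1 h2]] //.
have i1 : r / (msup s * msup s) <= at_root s a / (msup s * Rmax 1 (av a)).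
  apply: div_le_of_le_mul; first by nra.
  have -> : at_root s a / (msup s * Rmax 1 (av a)) * (msup s * msup s) =
          at_root s a * msup s / Rmax 1 (av a) by field; lra.
  apply: le_div_of_mul_le => //.
  by apply: (Rle_trans _ (msup s * Rmax 1 (av a))); nra.
have i2 : r / (msup s * Rmax 1 (av a)) <= at_root s a / (msup s * Rmax 1 (av a)).
  by apply: Rmult_le_compat_r; [apply/Rlt_le/Rinv_0_lt_compat | lra].
by rewrite (Rmax_left _ _ i1) (Rmax_left _ _ i2).
Qed.

(** The points above [zetaG] are the [zeta_{0,R}] with [R = u 'X >= 1]: the hypothesis gives one
    bound and the ultrametric inequality the other. *)
Lemma above_gauss_root u b : is_mult_seminorm av u ->
  (forall c, Rmax 1 (av c) <= at_root u c) ->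
  1 <= u 'X%ring /\ at_root u b = Rmax (u 'X%ring) (av b).
Proof.
move=> uP h; split.
  by have := h 0%ring; rewrite at_root0; have := Rmax_l 1 (av 0%ring); lra.
have := semi_root_le avP uP b; have := semiX_le_root avP uP b; have := h b.
by rmax_lra.
Qed.

Lemma sdist_above_gauss u p : is_mult_seminorm av u ->
  (forall c, Rmax 1 (av c) <= at_root u c) ->
  sdist (Some u) p = Rmax (sdist None p) (/ u 'X%ring).
Proof.
move=> uP h; have [R1 hR] := above_gauss_root 0%ring uP h.
have Mu : msup u = u 'X%ring by rewrite /msup Rmax_right.
rewrite !sdistE // Mu; case: p => [b|]; last first.
  by rewrite Rmax_right //; apply/Rlt_le/Rinv_0_lt_compat; lra.
have [_ ->] := above_gauss_root b uP h.
have H1 := Rmax_l 1 (av b); set H := Rmax 1 (av b) in H1 *.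
have -> : Rmax (u 'X%ring) (av b) = Rmax (u 'X%ring) H.
  by move: R1; rewrite /H; rmax_lra.
rewrite Rmax_div; last by nra.
by congr Rmax; field; lra.
Qed.

Lemma leB_zetaG u : is_mult_seminorm av u ->
  leB (zetaG av) (Some u) <-> (forall c, Rmax 1 (av c) <= at_root u c).
Proof.
move=> uP; split=> [h c|h k] /=.
  have := h ('X - c%:P)%ring; rewrite gaussNormE -(ball_semi_root avP c Rlt_0_1).
  exact.
rewrite gaussNormE; apply: (semi_le_of_roots avP _ uP); first by apply: ball_semi_mult => //; lra.
by move=> b; rewrite ball_semi_root //; lra.
Qed.

(** Describes the path from [x] to [zetaG] by distance functions. The value [c = 1] corresponds to
    [zetaG], and for [c >= diam x] the parameter is the diameter of [z], by [diamG_max]. *)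
Definition on_ray (z x : BPt K) : Prop :=
  exists2 c, 0 <= c <= 1 & forall p, sdist z p = Rmax (sdist x p) c.

(** The path first rises from [x] to the least common upper bound with [zetaG], then descends to
    [zetaG]. On the first piece [z] is an enlargement of the disc of [x], handled by [sdist_thick];
    on the second it is [zeta_{0,R}] and [c = 1 / R]. *)
Lemma onPath_on_ray z x : berk x -> onPath av z x (zetaG av) -> on_ray z x.
Proof.
move=> xP [zP [hz ub]].
have above u : is_mult_seminorm av u -> leB (zetaG av) (Some u) -> sdist x None <= / u 'X%ring ->
    on_ray (Some u) x.
  move=> uP /(leB_zetaG uP) h hx; have [R1 _] := above_gauss_root 0%ring uP h.
  have i1 : / u 'X%ring <= 1 by rewrite -Rinv_1; apply: Rinv_le_contravar; lra.
  have i0 : 0 < / u 'X%ring by apply: Rinv_0_lt_compat; lra.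
  exists (/ u 'X%ring) => [|p]; first by lra.
  rewrite sdist_above_gauss //; apply: (@sdist_merge_eq _ _ p None) => //.
  by rewrite sdistE //; lra.
case: x xP hz ub above => [s|] sP hz ub above; last first.
  case: z zP hz ub => [u|] uP hz ub.
    case: hz => // h; apply: above => //; rewrite sdistE //.
    by move/(leB_zetaG uP): h => h; have [R1 _] := above_gauss_root 0%ring uP h;
       apply/Rlt_le/Rinv_0_lt_compat; lra.
  exists 0 => [|p]; first by lra.
  by rewrite Rmax_left //; apply: sdist_ge0.
have M1 := msup_ge1 s; have M0 := msup_gt0 s.
have bP : is_mult_seminorm av (ball_semi av (msup s)) by apply: ball_semi_mult.
(* The point [zeta_{0, msup s}] is a common upper bound of [x] and [zetaG]. *)
have : leB z (Some (ball_semi av (msup s))).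
  apply: ub => //.
    apply: (semi_le_of_roots avP sP bP) => b; rewrite ball_semi_root //.
    apply: Rle_trans (semi_root_le avP sP b) _.
    by apply: Rle_max_compat; [exact: Rmax_r | lra].
  apply/(leB_zetaG bP) => c; rewrite ball_semi_root //.
  by apply: Rle_max_compat; lra.
case: z zP hz ub => [u|] uP hz ub // hu.
have uX : u 'X%ring <= msup s.
  have := hu 'X%ring; rewrite -(at_root0 (ball_semi _ _)) ball_semi_root // (nv0 (av_na_val avP)).
  by rewrite Rmax_left; lra.
case: hz => [su|gu]; last first.
  apply: above => //; rewrite sdistE //; apply: Rinv_le_contravar => //.
  by move/(leB_zetaG uP): gu => h; have [R1 _] := above_gauss_root 0%ring uP h; lra.
have Mu : msup u = msup s.
  have := su 'X%ring; move: uX; rewrite /msup.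
  by rmax_lra.
have d0 := diamInf_ge0 uP; have dM := diamInf_le_msup uP; rewrite Mu in dM.
exists (diamInf u / (msup s * msup s)) => [|p].
  split; first by apply: div_ge0 => //; nra.
  by apply: div_le_of_le_mul; nra.
apply: sdist_thick => // b.
apply: Rle_antisym; last by apply: Rmax_lub; [exact: diamInf_le | exact: su].
(* A centre [c] that nearly attains [diamInf u] is also close to [s], because [s <= u]; so [|b - c|]
   is controlled by [at_root s b]. *)
apply: le_all_eps => e e0.
have [r [c ->] hc] := is_glb_approx (diamInf_glb uP) e0.
have hsu : at_root s c <= at_root u c by apply: su.
have := semi_root_sub avP uP b c; have := adist_le avP sP b c; have := diamInf_le uP c.
by rmax_lra.
Qed.

(** The value at infinity, [/ msup u = max (/ msup s, c)], decides which piece contains [z]: for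
    [c <= / msup s] it lies above [x], otherwise above [zetaG]. A finite common upper bound is some
    [zeta_{0,R}] with [R >= msup s >= msup u]. *)
Lemma on_ray_onPath z x : berk z -> berk x -> on_ray z x -> onPath av z x (zetaG av).
Proof.
move=> zP xP [c [c0 c1] h]; split=> //.
case: z zP h => [u|] uP h; last first.
  have := h None; rewrite sdistE //; case: x xP h => [s|] sP h.
    rewrite sdistE // => e.
    have : 0 < / msup s by apply/Rinv_0_lt_compat/msup_gt0.
    by have := Rmax_l (/ msup s) c; lra.
  by split=> //; left.
have Mu := msup_gt0 u.
have hN := h None; rewrite sdistE // in hN.
have gu : / msup u = c -> leB (zetaG av) (Some u).
  move=> ec; apply/(leB_zetaG uP) => b.
  have := h (Some b); rewrite sdistE // => hb.
  have H1 := Rmax_l 1 (av b); set H := Rmax 1 (av b) in H1 hb *.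
  have : c <= at_root u b / (msup u * H) by rewrite hb; apply: Rmax_r.
  rewrite -ec => le.
  have MH : 0 < msup u * H by nra.
  have := Rmult_le_compat_r _ _ _ (Rlt_le _ _ MH) le.
  rewrite Rdiv_mulK; last by lra.
  have -> : / msup u * (msup u * H) = H by field; lra.
  exact.
case: x xP h hN => [s|] sP h hN; last first.
  split; last by case.
  by right; apply: gu; rewrite hN sdistE // Rmax_right.
have Ms := msup_gt0 s; rewrite sdistE // in hN.
have MuMs : msup u <= msup s.
  rewrite -(Rinv_inv (msup u)) -(Rinv_inv (msup s)); apply: Rinv_le_contravar.
    exact: Rinv_0_lt_compat.
  by rewrite hN; apply: Rmax_l.
split.
  case: (Rle_or_lt c (/ msup s)) => hc; last by right; apply: gu; rewrite hN Rmax_right //; lra.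
  left; apply: (semi_le_of_roots avP sP uP) => b.
  rewrite Rmax_left // in hN.
  have {hN}eM : msup u = msup s by rewrite -(Rinv_inv (msup u)) hN Rinv_inv.
  have := h (Some b); rewrite !sdistE // eM => hb.
  have H1 := Rmax_l 1 (av b); have MH : 0 < msup s * Rmax 1 (av b) by nra.
  have le : at_root s b / (msup s * Rmax 1 (av b)) <= at_root u b / (msup s * Rmax 1 (av b)).
    by rewrite hb; apply: Rmax_l.
  have := Rmult_le_compat_r _ _ _ (Rlt_le _ _ MH) le.
  by rewrite !Rdiv_mulK; lra.
case=> [t|] // tP st /(leB_zetaG tP) gt.
apply: (semi_le_of_roots avP uP tP) => b.
have [t1 ->] := above_gauss_root b tP gt.
apply: Rle_trans (semi_root_le avP uP b) _; apply: Rle_max_compat; last by lra.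
apply: (Rle_trans _ (msup u)); first exact: Rmax_r.
apply: Rle_trans MuMs _; apply: Rmax_lub => //; exact: st.
Qed.

Lemma on_ray_exists x c : berk x -> 0 <= c <= 1 ->
  exists2 z, berk z & forall p, sdist z p = Rmax (sdist x p) c.
Proof.
move=> xP [c0 c1]; case: (Req_dec c 0) => [->|nc].
  by exists x => // p; rewrite Rmax_left //; apply: sdist_ge0.
have {nc}c0 : 0 < c by lra.
have ic0 : 0 < / c by apply: Rinv_0_lt_compat.
have ic1 : 1 <= / c by rewrite -Rinv_1; apply: Rinv_le_contravar.
case: (Rle_or_lt (sdist x None) c) => hx.
  have bP : is_mult_seminorm av (ball_semi av (/ c)) by apply: ball_semi_mult.
  have bX : ball_semi av (/ c) 'X%ring = / c.
    by rewrite -at_root0 ball_semi_root // (nv0 (av_na_val avP)) Rmax_left; lra.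
  exists (Some (ball_semi av (/ c))) => // p.
  rewrite sdist_above_gauss // => [|b]; last first.
    by rewrite ball_semi_root //; apply: Rle_max_compat; lra.
  rewrite bX Rinv_inv; apply: (@sdist_merge_eq _ _ p None) => //.
  by rewrite sdistE //; lra.
case: x xP hx => [s|] sP hx; last by rewrite sdistE // in hx; lra.
rewrite sdistE // in hx; have M0 := msup_gt0 s.
(* The radius for which [sdist_thick] yields the constant [c]. *)
set r := c * (msup s * msup s).
have r0 : 0 < r by apply: Rmult_lt_0_compat => //; apply: Rmult_lt_0_compat.
have rM : r <= msup s.
  have := Rmult_lt_compat_r _ _ _ M0 hx; rewrite Rinv_l; last by lra.
  by rewrite /r; nra.
have tP := thicken_mult avP sP r0.
exists (Some (thicken s r)) => // p.
have -> : c = r / (msup s * msup s) by rewrite /r; field; lra.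
by apply: sdist_thick => // [|b]; [lra | rewrite (thicken_root avP)].
Qed.

(** * The diameter of the join as a joint infimum *)

Lemma joint_inf_exists x y : berk x -> berk y ->
  exists2 c, 0 <= c <= 1 &
    (forall p, c <= Rmax (sdist x p) (sdist y p)) /\
    (forall e, 0 < e -> exists p, Rmax (sdist x p) (sdist y p) < c + e).
Proof.
move=> xP yP; pose S r := exists p, r = Rmax (sdist x p) (sdist y p).
have S0 r : S r -> 0 <= r by move=> [p ->]; apply/Rmax_ge0_l/sdist_ge0.
have Sne : exists r, S r by eexists; exists None.
have glb := Rinf_is_glb Sne S0; have [lb hi] := glb.
exists (Rinf S); last first.
  split=> [p|e e0]; first by apply: lb; exists p.
  by have [r [p ->] hp] := is_glb_approx glb e0; exists p.
split; first exact: hi.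
apply: (Rle_trans _ (Rmax (sdist x None) (sdist y None))); first by apply: lb; exists None.
by apply: Rmax_lub; apply: sdist_le1.
Qed.

Lemma sdist_merge_inf x y c : berk x -> berk y ->
  (forall e, 0 < e -> exists p, Rmax (sdist x p) (sdist y p) < c + e) ->
  forall p, Rmax (sdist x p) c = Rmax (sdist y p) c.
Proof.
move=> xP yP h p.
have half a b : berk a -> berk b ->
    (forall e, 0 < e -> exists p, Rmax (sdist a p) (sdist b p) < c + e) ->
    Rmax (sdist a p) c <= Rmax (sdist b p) c.
  move=> aP bP hab; apply: Rmax_lub; last exact: Rmax_r.
  apply: le_all_eps => e e0; have [q hq] := hab e e0.
  have := sdist_merge p q aP bP; move: hq.
  by rmax_lra.
apply: Rle_antisym; apply: half => // e e0.
by have [q hq] := h e e0; exists q; rewrite Rmax_comm.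
Qed.

(** The point [z] at level [c], the joint infimum, on the path from [x] satisfies the specification
    of the join. [joinG] is only a choice among such points, but any two of them have the same
    distance function. *)
Lemma diamG_join x y : berk x -> berk y ->
  0 <= diam (joinG av x y) <= 1 /\
  (forall p, diam (joinG av x y) <= Rmax (sdist x p) (sdist y p)) /\
  (forall e, 0 < e -> exists p, Rmax (sdist x p) (sdist y p) < diam (joinG av x y) + e).
Proof.
move=> xP yP; have [c c01 [lb ap]] := joint_inf_exists xP yP.
suff -> : diam (joinG av x y) = c by [].
have mg := sdist_merge_inf xP yP ap.
have [z zP hz] := on_ray_exists xP c01.
have zx : onPath av z x (zetaG av) by apply: on_ray_onPath => //; exists c.
have zy : onPath av z y (zetaG av).
  by apply: on_ray_onPath => //; exists c => // p; rewrite hz mg.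
have zw w : onPath av w x (zetaG av) -> onPath av w y (zetaG av) -> onPath av w z (zetaG av).
  move=> wx wy; have wP : berk w by case: wx.
  have [c1 c1P h1] := onPath_on_ray xP wx; have [c2 c2P h2] := onPath_on_ray yP wy.
  apply: on_ray_onPath => //; exists c1 => // p; rewrite hz.
  (* The distance function of [w] dominates those of [x] and [y], hence also [c]. *)
  have := lb p; have := h1 p; have := h2 p.
  by rmax_lra.
have ex : exists z, onPath av z x (zetaG av) /\ onPath av z y (zetaG av) /\
    (forall w, onPath av w x (zetaG av) -> onPath av w y (zetaG av) ->
       onPath av w z (zetaG av)) by exists z.
have [jx [jy jw]] := epsilon_spec (inhabits None) _ ex.
rewrite -/(joinG av x y) in jx jy jw.
have jP : berk (joinG av x y) by case: jx.
(* The chosen join and [z] lie on each other's path to [zetaG], so each distance function dominates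
   the other. *)
have [c1 _ h1] := onPath_on_ray zP (zw _ jx jy).
have [c2 _ h2] := onPath_on_ray jP (jw _ zx zy).
have e p : sdist (joinG av x y) p = sdist z p.
  have := h1 p; have := h2 p.
  by rmax_lra.
have hj p : sdist (joinG av x y) p = Rmax (sdist x p) c by rewrite e hz.
rewrite (diamG_max jP xP hj) Rmax_right //.
apply: le_all_eps => eps e0; have [p hp] := ap eps e0.
have := diamG_le p xP; have := Rmax_l (sdist x p) (sdist y p); lra.
Qed.

Lemma join_le x y p : berk x -> berk y -> diam (joinG av x y) <= Rmax (sdist x p) (sdist y p).
Proof. by move=> xP yP; case: (diamG_join xP yP) => _ []. Qed.

Lemma join_approx x y e : berk x -> berk y -> 0 < e ->
  exists p, Rmax (sdist x p) (sdist y p) < diam (joinG av x y) + e.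
Proof. by move=> xP yP; case: (diamG_join xP yP) => _ [_ h] /h. Qed.

Lemma diamG_le_join x y : berk x -> berk y ->
  diam x <= diam (joinG av x y) /\ diam y <= diam (joinG av x y).
Proof.
move=> xP yP; split; apply: le_all_eps => e e0; have [p hp] := join_approx xP yP e0.
  by have := diamG_le p xP; have := Rmax_l (sdist x p) (sdist y p); lra.
by have := diamG_le p yP; have := Rmax_r (sdist x p) (sdist y p); lra.
Qed.

Lemma dFRL_ge0 x y : berk x -> berk y -> 0 <= dFRL av x y.
Proof. by move=> xP yP; have [] := diamG_le_join xP yP; rewrite /dFRL; lra. Qed.

(** The diameters of joins satisfy the ultrametric inequality, and the smaller join on the right
    still has diameter at least [diam y], which pays for the two terms [- diam y]. *)
Lemma dFRL_triangle x y z : berk x -> berk y -> berk z ->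
  dFRL av x z <= dFRL av x y + dFRL av y z.
Proof.
move=> xP yP zP.
suff : diam (joinG av x z) <= Rmax (diam (joinG av x y)) (diam (joinG av y z)).
  have [_] := diamG_le_join xP yP; have [h _] := diamG_le_join yP zP; rewrite /dFRL.
  by move: h; rmax_lra.
apply: le_all_eps => e e0.
have [p hp] := join_approx xP yP e0; have [q hq] := join_approx yP zP e0.
have := join_le p xP zP; have := sdist_merge p q zP yP; move: hp hq.
by rmax_lra.
Qed.

End Paths.

(** * Action of a rational map *)

Section Homogenization.
Variables (K : closedFieldType) (av : K -> R).
Hypothesis avP : is_na_abs av.

Lemma evalSemi_mult a : is_mult_seminorm av (evalSemi av a).
Proof.
have avV := av_na_val avP; apply: na_val_semi; first split; rewrite /evalSemi.
- by move=> h; apply: nv_ge0.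
- by rewrite horner0 nv0.
- by rewrite hornerC nv1.
- by move=> h k; rewrite hornerM nvM.
- by move=> h k; rewrite hornerD; apply: nvD.
- by move=> c; rewrite hornerC.
Qed.

Variables f g : {poly K}.

(** The form [h(F, G)] with [h] taken as a form of degree [n]. Fixing [n], instead of reading it off
    [h] as [homcomp] does, makes this linear in [h]. *)
Definition hcomp (n : nat) (h : {poly K}) : {poly K} :=
  (\sum_(i < n.+1) h`_i *: (f ^+ i * g ^+ (n - i)))%ring.

Lemma hcompD n h k : hcomp n (h + k)%ring = (hcomp n h + hcomp n k)%ring.
Proof. by rewrite /hcomp -big_split; apply: eq_bigr => i _; rewrite coefD scalerDl. Qed.

Lemma hcompZ n c h : hcomp n (c *: h)%ring = (c *: hcomp n h)%ring.
Proof. by rewrite /hcomp scaler_sumr; apply: eq_bigr => i _; rewrite coefZ scalerA. Qed.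

Lemma hcompB n h k : hcomp n (h - k)%ring = (hcomp n h - hcomp n k)%ring.
Proof. by rewrite hcompD -scaleN1r hcompZ scaleN1r. Qed.

Lemma hcompS n (h : {poly K}) : (size h <= n.+1)%N -> hcomp n.+1 h = (g * hcomp n h)%ring.
Proof.
move=> sh; rewrite /hcomp big_ord_recr /= [X in (_ + X *: _)%ring]nth_default // scale0r addr0.
rewrite mulr_sumr; apply: eq_bigr => i _.
by rewrite (subSn (leq_ord i)) exprS -scalerAr; congr (_ *: _)%ring; rewrite mulrCA.
Qed.

Lemma hcompX n (h : {poly K}) : hcomp n.+1 ('X * h)%ring = (f * hcomp n h)%ring.
Proof.
rewrite /hcomp big_ord_recl coefXM /= scale0r add0r mulr_sumr.
by apply: eq_bigr => i _; rewrite coefXM /= exprS -scalerAr mulrA.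
Qed.

Lemma hcomp_lform n p (h : {poly K}) : (size h <= n.+1)%N ->
  hcomp n.+1 (lform p * h)%ring = (pform f g p * hcomp n h)%ring.
Proof.
move=> sh; rewrite /lform /pform !mulrBl -!scalerAl mul1r.
by rewrite hcompB !hcompZ hcompX hcompS.
Qed.

Lemma hcomp_deg0 h : hcomp 0 h = (h`_0)%:P%ring.
Proof. by rewrite /hcomp big_ord1 !expr0 mulr1 alg_polyC. Qed.

Lemma hcomp1_lform p : hcomp 1 (lform p) = pform f g p.
Proof. by have := @hcomp_lform 0 p 1%ring; rewrite size_poly1 !mulr1 hcomp_deg0 coefC mulr1 => ->. Qed.

(** Linear factors of [h] are split off one at a time, and [hcomp_lform] treats each of them. *)
Lemma hcompM m n (h k : {poly K}) : (size h <= m.+1)%N -> (size k <= n.+1)%N ->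
  hcomp (m + n) (h * k)%ring = (hcomp m h * hcomp n k)%ring.
Proof.
elim: m h => [|m IH] h sh sk.
  by rewrite (size1_polyC sh) mul_polyC hcompZ hcomp_deg0 coefC mul_polyC.
have [p [l [sl ->]]] := linear_factor sh.
rewrite addSn -mulrA !hcomp_lform // ?IH // ?mulrA //.
apply: leq_trans (size_polyMleq _ _) _.
by rewrite -subn1 leq_subLR add1n -addnS -addSn leq_add.
Qed.

Lemma homcompE h : homcomp f g h = hcomp (size h).-1 h.
Proof.
rewrite /homcomp /hcomp; case e : (size h) => [|n] //=.
by rewrite big_ord0 big_ord1 nth_default ?e // scale0r.
Qed.

Section Pushforward.
Variable s : {poly K} -> R.
Hypothesis sP : is_mult_seminorm av s.
Hypothesis sg : s g <> 0.

Definition push (h : {poly K}) : R := s (homcomp f g h) / s g ^ (size h).-1.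

(** Raising [n] by one multiplies numerator and denominator by [s g]. A common [n] is what allows
    sums of polynomials of different degrees. *)
Lemma pushE n (h : {poly K}) : (size h <= n.+1)%N -> push h = s (hcomp n h) / s g ^ n.
Proof.
have sV := semi_na_val avP sP.
rewrite /push homcompE => sh.
have {sh} : ((size h).-1 <= n)%N by rewrite -subn1 leq_subLR.
elim: n => [|n IH]; first by rewrite leqn0 => /eqP ->.
rewrite leq_eqVlt => /orP[/eqP -> //|]; rewrite ltnS => le; rewrite IH //.
have sh : (size h <= n.+1)%N by case: (size h) le.
rewrite hcompS // (nvM sV) /=; field.
by split=> //; apply: pow_nonzero.
Qed.

Lemma push_mult : is_mult_seminorm av push.
Proof.
have sV := semi_na_val avP sP; have g0 : 0 < s g by have := nv_ge0 sV g; lra.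
have gn n : 0 < s g ^ n by apply: pow_lt.
have pC c : push c%:P = av c.
  by rewrite (@pushE 0) ?size_polyC_leq1 // hcomp_deg0 coefC (semiC sP) /= /Rdiv Rinv_1 Rmult_1_r.
apply: na_val_semi => //; split.
- by move=> h; apply: div_ge0 => //; apply: nv_ge0.
- by rewrite -(polyC0 K) pC (nv0 (av_na_val avP)).
- by rewrite -(polyC1 K) pC (nv1 (av_na_val avP)).
- move=> h k; rewrite (@pushE (size h) h) // (@pushE (size k) k) //.
  rewrite (@pushE (size h + size k) (h * k)%ring); last first.
    by apply: leq_trans (size_polyMleq _ _) _; apply: leq_trans (leq_pred _) _.
  rewrite hcompM // (nvM sV) pow_add.
  by have := gn (size h); have := gn (size k) => ? ?; field; lra.
- move=> h k; set n := maxn (size h) (size k).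
  rewrite (@pushE n h) ?leqW ?leq_maxl // (@pushE n k) ?leqW ?leq_maxr //.
  rewrite (@pushE n (h + k)%ring) ?leqW // ?(leq_trans (size_polyD _ _)) //.
  rewrite hcompD -Rmax_div //; apply: Rmult_le_compat_r; last exact: nvD.
  exact/Rlt_le/Rinv_0_lt_compat.
Qed.

Lemma push_lform p : push (lform p) = s (pform f g p) / s g.
Proof. by rewrite (@pushE 1) ?size_lform // hcomp1_lform /= Rmult_1_r. Qed.

Lemma pushX : push 'X%ring = s f / s g.
Proof.
by have := push_lform (Some 0%ring); rewrite lformE /pform /= subr0 scale1r scale0r subr0.
Qed.

End Pushforward.

Lemma phiB_SomeE d s : phiB av d f g (Some s) = if Req_EM_T (s g) 0 then None else Some (push s).
Proof. by []. Qed.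

Lemma phiB_berk d x : isBerk av x -> isBerk av (phiB av d f g x).
Proof.
case: x => [s|] sP; last by rewrite /=; case: ifP => // _; apply: evalSemi_mult.
by rewrite phiB_SomeE; case: Req_EM_T => // ne; apply: push_mult.
Qed.

Definition mnorm d x := Rmax (hnorm av x d f) (hnorm av x d g).

(** Pulling back the linear form of [q] gives [pform f g q], and the pulled back coordinates
    [(F, G)] have norm [mnorm d x]. The formula is uniform in finite and infinite arguments and
    values. *)
Lemma sdist_phiB d x q : isBerk av x -> 0 < mnorm d x ->
  sdist av (phiB av d f g x) q = hnorm av x d (pform f g q) / (ht av q * mnorm d x).
Proof.
move=> xP; have yP := phiB_berk d xP; have avV := av_na_val avP.
have Hq := ht_gt0 avP q.
case: x xP yP => [s|] sP yP; last first.
  move: yP; rewrite /mnorm /= => yP N0; rewrite /sdist /pform coefB !coefZ.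
  case: ifPn yP => [ng|/negPn/eqP eg] yP /=.
    have gd := av_gt0 avP ng.
    rewrite /lform /pform /evalSemi /msup hornerD hornerN !hornerZ hornerX hornerC !mulr1 Rmult_1_r.
    have -> : ((vec q).2 * (f`_d / g`_d) - (vec q).1 = ((vec q).2 * f`_d - (vec q).1 * g`_d) / g`_d)%ring.
      by rewrite mulrBl mulrA mulfK.
    rewrite !(av_div avP) //.
    rewrite Rmax_1_div //.
    move: (av _) (av (g`_d)%ring) (Rmax _ _) gd N0 => A G N gd N0.
    by field; lra.
  have e : Rmax (av (f`_d)%ring) (av (g`_d)%ring) = av (f`_d)%ring.
    by rewrite eg (nv0 avV) Rmax_left //; apply: nv_ge0.
  move: N0; rewrite {}e eg mulr0 subr0 (nvM avV) => f0.
  rewrite /lform /pform coefB !coefZ coefX coef1 /= mulr1 mulr0 subr0.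
  move: (av (f`_d)%ring) f0 => F f0; by field; lra.
rewrite /mnorm !hnorm_Some.
have sV := semi_na_val avP sP; have Md := pow_lt _ d (msup_gt0 s).
have f0 := nv_ge0 sV f; have g0 := nv_ge0 sV g.
rewrite -!Rmax_div // => N0.
have {}N0 : 0 < Rmax (s f) (s g).
  by move: (Rmult_lt_compat_r _ _ _ Md N0); rewrite Rdiv_mulK; lra.
move: yP; rewrite phiB_SomeE; case: Req_EM_T => [eg|ng] yP.
  have ef : 0 < s f by move: N0; rewrite eg; rmax_lra.
  (* Here [phi x] is infinity, and [g] has value 0, so only the term in [f] counts. *)
  have -> : s (pform f g q) = av (vec q).2 * s f.
    rewrite /pform -(semiZ avP sP).
    have e : s ((vec q).1 *: g)%ring = 0 by rewrite (semiZ avP sP) eg Rmult_0_r.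
    apply: Rle_antisym.
      apply: Rle_trans (nvB sV _ _) _; rewrite e.
      by apply: Rmax_lub; [exact: Rle_refl | exact: nv_ge0].
    rewrite -{1}(subrK ((vec q).1 *: g)%ring ((vec q).2 *: f)%ring).
    apply: Rle_trans (nvD sV _ _) _; rewrite e.
    by apply: Rmax_lub; [exact: Rle_refl | exact: nv_ge0].
  rewrite /sdist /= /lform /pform coefB !coefZ coefX coef1 /= mulr1 mulr0 subr0 eg.
  by rewrite Rmax_left; [field; lra | lra].
have {}g0 : 0 < s g by lra.
rewrite /sdist hnorm_Some pow_1 push_lform // {1}/msup pushX //.
rewrite Rmax_1_div //.
by rewrite -/(msup s); field; lra.
Qed.

End Homogenization.

(** * The resultant bound *)

Section Resultant.
Variables (K : closedFieldType) (av : K -> R).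
Hypothesis avP : is_na_abs av.

Lemma det_in_O n (A : 'M[K]_n) : (forall i j, in_O av (A i j)) -> in_O av (\det A)%ring.
Proof.
have avV := av_na_val avP; rewrite /in_O => hA.
apply: (nv_sum avV) => [|s _]; first exact: Rle_0_1.
rewrite (nvM avV) (nvX avV) (nvN avV) (nv1 avV) pow1 Rmult_1_l.
elim/big_rec: _ => [|i x _ IH]; first by rewrite (nv1 avV); exact: Rle_refl.
rewrite (nvM avV) -(Rmult_1_l R1).
by apply: Rmult_le_compat => //; apply: nv_ge0.
Qed.

Lemma adj_in_O n (A : 'M[K]_n) i j : (forall i j, in_O av (A i j)) -> in_O av (\adj A i j)%ring.
Proof.
have avV := av_na_val avP; move=> hA; rewrite mxE /cofactor /in_O.
rewrite (nvM avV) (nvX avV) (nvN avV) (nv1 avV) pow1 Rmult_1_l.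
by apply: det_in_O => k l; rewrite !mxE.
Qed.

Variables (d : nat) (f g : {poly K}).
Hypothesis sf : (size f <= d.+1)%N.
Hypothesis sg : (size g <= d.+1)%N.

Definition vpoly (c : 'I_d -> K) : {poly K} := (\sum_(i < d) c i *: 'X^i)%ring.

Lemma size_vpoly c : (size (vpoly c) <= d)%N.
Proof.
apply/leq_sizeP => j dj; rewrite coef_sum big1 // => i _.
by rewrite coefZ coefXn gtn_eqF ?mulr0 // (leq_trans (ltn_ord i)).
Qed.

(** The halves of [v] are the coefficients of [A] and [B] in [A f + B g]; this is multiplication by
    the Sylvester matrix ([coef_comb]). *)
Definition comb (v : 'rV[K]_(d + d)) : {poly K} :=
  (vpoly (fun i => v 0 (lshift d i)) * f + vpoly (fun i => v 0 (rshift d i)) * g)%ring.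

Lemma coef_vpolyM c (h : {poly K}) j :
  ((vpoly c * h)`_j = \sum_(i < d) c i * (if (j < i)%N then 0 else h`_(j - i)))%ring.
Proof.
rewrite /vpoly mulr_suml coef_sum; apply: eq_bigr => i _.
by rewrite -scalerAl coefZ coefXnM.
Qed.

Lemma coef_comb v (j : 'I_(d + d)) : ((comb v)`_j = (v *m sylvester d f g) 0 j)%ring.
Proof.
rewrite /comb coefD !coef_vpolyM mxE big_split_ord /=.
congr (_ + _)%ring; apply: eq_bigr => i _; rewrite mxE /=.
  by rewrite ltn_ord ltnNge; case: (i <= j)%N.
have -> : (d + i < d)%N = false by apply/negbTE; rewrite -leqNgt leq_addr.
by rewrite addKn ltnNge; case: (i <= j)%N.
Qed.

Lemma size_comb v : (size (comb v) <= d + d)%N.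
Proof.
have sM (c : 'I_d -> K) (h : {poly K}) : (size h <= d.+1)%N -> (size (vpoly c * h)%ring <= d + d)%N.
  move=> sh; apply: leq_trans (size_polyMleq _ _) _.
  by rewrite -subn1 leq_subLR add1n -addnS leq_add // size_vpoly.
by apply: leq_trans (size_polyD _ _) _; rewrite geq_max !sM.
Qed.

(** Cramer's rule [adj(S) S = det(S)], read row by row. In terms of forms, [Res X^k Y^(2d-1-k)] is a
    combination of F and G. *)
Lemma comb_adj (k : 'I_(d + d)) :
  comb (row k (\adj (sylvester d f g))) = (Res d f g *: 'X^k)%ring.
Proof.
apply/polyP => j; case: (ltnP j (d + d)) => hj; last first.
  rewrite nth_default; last by apply: leq_trans (size_comb _) hj.
  by rewrite coefZ coefXn gtn_eqF ?mulr0 // (leq_trans (ltn_ord k)).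
have -> : j = Ordinal hj :> nat by [].
rewrite coef_comb -row_mul mul_adj_mx rowE mul_mx_scalar mxE mxE coefZ coefXn.
by rewrite eqxx -val_eqE.
Qed.

(** A kernel vector gives [A f = - B g] with [A], [B] of degree below [d]. Whichever of [f], [g] has
    degree exactly [d] divides, by coprimality, the cofactor of the other, which must vanish. *)
Lemma Res_neq0 : coprimep f g -> (size f == d.+1) || (size g == d.+1) -> Res d f g != 0%ring.
Proof.
move=> cop szs; apply/negP => /det0P[v nv vS].
have cv : comb v = 0%ring.
  apply/polyP => j; case: (ltnP j (d + d)) => hj; last first.
    by rewrite coef0 nth_default //; apply: leq_trans (size_comb _) hj.
  have -> : j = Ordinal hj :> nat by [].
  by rewrite coef_comb vS mxE coef0.
set A := vpoly (fun i => v 0%ring (lshift d i)).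
set B := vpoly (fun i => v 0%ring (rshift d i)).
have vA0 c : vpoly c = 0%ring -> forall i, c i = 0%ring.
  move=> e i; have := coef_vpolyM c 1%ring i; rewrite mulr1 e coef0 (bigD1 i) //= ltnn subnn coef1 mulr1.
  rewrite big1 ?addr0 // => j nji; case: ltnP => [|ij]; first by rewrite mulr0.
  rewrite coef1 subn_eq0 leqNgt ltn_neqAle ij andbT eq_sym.
  by rewrite (inj_eq val_inj) eq_sym nji mulr0.
suff [A0 B0] : A = 0%ring /\ B = 0%ring.
  case/eqP: nv; apply/rowP => j; rewrite mxE; case: (splitP j) => i ej.
    by have := vA0 _ A0 i; congr (v _ _ = _); apply: val_inj.
  by have := vA0 _ B0 i; congr (v _ _ = _); apply: val_inj.
have e : (A * f = - (B * g))%ring by apply/eqP; rewrite -addr_eq0; apply/eqP.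
have small (p q r t : {poly K}) : coprimep p q -> size p = d.+1 -> (size t <= d)%N ->
    (r * p = - (t * q))%ring -> r = 0%ring /\ t = 0%ring.
  move=> pq sp st ert.
  have t0 : t = 0%ring.
    have : (p %| t * q)%ring by rewrite -dvdpNr -ert dvdp_mull.
    rewrite Gauss_dvdpl // => pt; apply/eqP; case: (eqVneq t 0%ring) => // nt.
    by have := dvdp_leq nt pt; rewrite sp leqNgt ltnS st.
  split=> //; move/eqP: ert; rewrite t0 mul0r oppr0 mulf_eq0 => /orP[/eqP //|/eqP p0].
  by rewrite p0 size_poly0 in sp.
case/orP: szs => /eqP sz; first by apply: (small f g A B) => //; apply: size_vpoly.
have [] := small g f B A _ sz _ _ => //; first by rewrite coprimep_sym.
- exact: size_vpoly.
- by rewrite e opprK.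
Qed.

Hypothesis d0 : (0 < d)%N.
Hypothesis fO : forall i, in_O av (f`_i)%ring.
Hypothesis gO : forall i, in_O av (g`_i)%ring.

Lemma hnormXn x n : isBerk av x -> hnorm av x n 'X^n%ring = hnorm av x 1 'X%ring ^ n.
Proof.
move=> xP; elim: n => [|n IH].
  by rewrite hnorm_deg0 // ?expr0 ?size_poly1 // coef1 (nv1 (av_na_val avP)).
by rewrite exprS -[in LHS]add1n hnormM ?size_polyX ?size_polyXn // IH.
Qed.

Lemma hnorm_one x n : isBerk av x -> hnorm av x n 1%ring = hnorm av x 1 1%ring ^ n.
Proof.
move=> xP; elim: n => [|n IH].
  by rewrite hnorm_deg0 // ?size_poly1 // coef1 (nv1 (av_na_val avP)).
by rewrite -[X in hnorm _ _ _ X]mul1r -[in LHS]add1n hnormM ?size_poly1 // IH.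
Qed.

Lemma sylvester_in_O i j : in_O av (sylvester d f g i j).
Proof.
have z : in_O av 0%ring by rewrite /in_O (nv0 (av_na_val avP)); exact: Rle_0_1.
by rewrite mxE; case: ifP => _; case: ifP.
Qed.

Lemma coef_vpoly_in_O c i : (forall k, in_O av (c k)) -> in_O av ((vpoly c)`_i)%ring.
Proof.
have avV := av_na_val avP; move=> hc.
have := coef_vpolyM c 1%ring i; rewrite mulr1 => ->.
apply: (nv_sum avV) => [|k _]; first exact: Rle_0_1.
case: ltnP => _; first by rewrite mulr0 (nv0 avV); exact: Rle_0_1.
rewrite coef1; case: eqP => _; first by rewrite mulr1; apply: hc.
by rewrite mulr0 (nv0 avV); exact: Rle_0_1.
Qed.

(** The combinations from [comb_adj] have integral coefficients. Take [k = 2d - 1] if X has norm 1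
    at [x], and [k = 0] if Y has. *)
Lemma Res_le_mnorm x : isBerk av x -> av (Res d f g) <= mnorm av f g d x.
Proof.
move=> xP; have avV := av_na_val avP; set N := mnorm _ _ _ _ _.
have ed : (d = d.-1.+1)%N by rewrite prednK.
have N0 : 0 <= N by apply/Rmax_ge0_l/hnorm_ge0.
have bound (k : 'I_(d + d)) : hnorm av x (d.-1 + d) (Res d f g *: 'X^k)%ring <= N.
  rewrite -comb_adj /comb.
  have b c (h : {poly K}) : (forall i, in_O av (c i)) -> (size h <= d.+1)%N -> hnorm av x d h <= N ->
      hnorm av x (d.-1 + d) (vpoly c * h)%ring <= N.
    move=> hc sh hN; rewrite hnormM // -?ed ?size_vpoly //.
    have h1 : hnorm av x d.-1 (vpoly c) <= 1.
      apply: hnorm_le; rewrite -?ed ?size_vpoly //; first exact: Rle_0_1.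
      by move=> i; apply: coef_vpoly_in_O.
    by have := hnorm_ge0 avP xP d.-1 (vpoly c); have := hnorm_ge0 avP xP d h; nra.
  apply: Rle_trans (hnormD avP xP _ _ _) _; apply: Rmax_lub; apply: b => //.
  - by move=> i; rewrite mxE; apply: adj_in_O sylvester_in_O.
  - exact: Rmax_l.
  - by move=> i; rewrite mxE; apply: adj_in_O sylvester_in_O.
  - exact: Rmax_r.
have := hnorm_basis avP xP; case: (Rmax_spec (hnorm av x 1 'X%ring) (hnorm av x 1 1%ring)) => -[_ ->] e1.
  have hk : (d.-1 + d < d + d)%N by rewrite ltn_add2r ltn_predL.
  have := bound (Ordinal hk); rewrite hnormZ //= hnormXn // e1 pow1 Rmult_1_r; exact.
have hk : (0 < d + d)%N by rewrite addn_gt0 d0.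
by have := bound (Ordinal hk); rewrite hnormZ //= expr0 hnorm_one // e1 pow1 Rmult_1_r; exact.
Qed.

(** The form vanishes at [p]. At infinity this means that its top coefficient is 0, and the linear
    factor is the constant -1. *)
Lemma pform_phiK_dvd p : exists2 k : {poly K}, (size k <= d)%N &
  pform f g (phiK d f g p) = (lform p * k)%ring.
Proof.
set H := pform _ _ _.
have sH : (size H <= d.+1)%N.
  apply: leq_trans (size_polyD _ _) _; rewrite size_polyN geq_max.
  by rewrite !(leq_trans (size_scale_leq _ _)).
case: p @H sH => [a|] H sH.
  have /factor_theorem [k hk] : root H a.
    rewrite /root /H /pform /phiK hornerD hornerN !hornerZ; case: ifPn => [ng|/negPn/eqP ->] /=.
      by rewrite mul1r divfK // subrr.
    by rewrite mul0r mulr0 subrr.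
  exists k; last by rewrite lformE hk mulrC.
  move: sH; rewrite hk; case: (eqVneq k 0%ring) => [->|nk]; first by rewrite size_poly0.
  by rewrite size_Mmonic ?monicXsubC // size_XsubC addn2.
exists (- H)%ring; last by rewrite lformE mulN1r opprK.
rewrite size_polyN.
have Hd : (H`_d = 0)%ring.
  rewrite /H /pform /phiK coefB !coefZ; case: ifPn => [ng|/negPn/eqP ->] /=.
    by rewrite mul1r divfK // subrr.
  by rewrite mul0r mulr0 subrr.
apply/leq_sizeP => j; rewrite leq_eqVlt => /orP[/eqP <- //|dj].
by rewrite nth_default // (leq_trans sH).
Qed.

Lemma coef_pform_le q i : av ((pform f g q)`_i)%ring <= ht av q.
Proof.
have avV := av_na_val avP; rewrite /pform coefB !coefZ.
apply: Rle_trans (nvB avV _ _) _; rewrite !(nvM avV) /ht Rmax_comm.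
have b a c : in_O av c -> av a * av c <= av a.
  by rewrite /in_O => hc; have := nv_ge0 avV a; nra.
by apply: Rle_max_compat; apply: b.
Qed.

(** Multiplicativity of the Gauss norm bounds the coefficients of the cofactor of [lform p] by
    [ht q / ht p], hence its norm at [x] as well. *)
Lemma hnorm_pform_phiK x p : isBerk av x ->
  hnorm av x d (pform f g (phiK d f g p)) <= ht av (phiK d f g p) * sdist av x p.
Proof.
move=> xP; have [k sk e] := pform_phiK_dvd p; set q := phiK d f g p in e *.
have ed : (d = d.-1.+1)%N by rewrite prednK.
have Hp := ht_gt0 avP p; have Hq := ht_gt0 avP q.
have kc i : av (k`_i)%ring <= ht av q / ht av p.
  apply: le_div_of_mul_le => //.
  have bV := semi_na_val avP (ball_semi_mult avP Rlt_0_1).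
  have el : ball_semi av 1 (lform p) = ht av p.
    rewrite lformE htE //; case: (p) => [a|].
      by rewrite -/(at_root (ball_semi av 1) a) ball_semi_root //; lra.
    by rewrite (nvN bV) (nv1 bV).
  have h1 : av (k`_i)%ring <= ball_semi av 1 k.
    by have := gauss_coef (av_na_val avP) 1 k i; rewrite pow1 Rmult_1_r.
  apply: (Rle_trans _ (ball_semi av 1 (pform f g q))).
    by rewrite e (nvM bV) el Rmult_comm; apply: Rmult_le_compat_l => //; lra.
  apply: gauss_le => [|j]; first by lra.
  by rewrite pow1 Rmult_1_r; apply: coef_pform_le.
rewrite e {1}ed -add1n hnormM ?size_lform -?ed // hnorm_lform //.
have hk : hnorm av x d.-1 k <= ht av q / ht av p.
  by apply: hnorm_le; rewrite -?ed //; apply: div_ge0 => //; lra.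
have -> : ht av q * sdist av x p = ht av p * sdist av x p * (ht av q / ht av p) by field; lra.
apply: Rmult_le_compat_l => //; have := sdist_ge0 avP xP p; nra.
Qed.

End Resultant.

(** * Lipschitz estimates *)

(* Includes [b = 0], where [a / b = 0]. *)
Lemma ratio_le (a b c : R) : 0 <= b -> 0 <= c -> a <= c * b -> a / b <= c.
Proof.
move=> b0 c0 h; case: (Req_dec b 0) => [->|nb].
  by rewrite /Rdiv Rinv_0 Rmult_0_r.
by apply: div_le_of_le_mul; lra.
Qed.

Lemma one_sub_pow_le (t : R) n : 0 <= t <= 1 -> 1 - t ^ n <= INR n * (1 - t).
Proof.
move=> [t0 t1]; elim: n => [|n IH]; first by rewrite /=; lra.
rewrite S_INR /=; have := pos_INR n.
have : t * (1 - t ^ n) <= 1 * (INR n * (1 - t)).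
  apply: (Rle_trans _ (t * (INR n * (1 - t)))); first exact: Rmult_le_compat_l.
  by apply: Rmult_le_compat_r => //; apply: Rmult_le_pos; [exact: pos_INR | lra].
lra.
Qed.

Section Lipschitz.
Variables (K : closedFieldType) (av : K -> R).
Hypothesis avP : is_na_abs av.
Variables (d : nat) (f g : {poly K}).
Hypothesis d0 : (0 < d)%N.
Hypothesis rep : normalized_rep av d f g.

Notation sdist := (@sdist K av).
Notation diam := (@diamG K).
Notation berk := (isBerk av).
Notation phi := (phiB av d f g).
Notation res := (av (Res d f g)).
Notation join := (joinG av).

Lemma res_gt0 : 0 < res.
Proof. by case: rep => sf sg [cop sz] _ _; apply: av_gt0 => //; apply: Res_neq0. Qed.

Lemma mnorm_ge_res x : berk x -> res <= mnorm av f g d x.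
Proof. by case: rep => sf sg _ [fO gO] _ xP; apply: Res_le_mnorm. Qed.

Lemma mnorm_gt0 x : berk x -> 0 < mnorm av f g d x.
Proof. by move=> /mnorm_ge_res; have := res_gt0; lra. Qed.

Lemma sdist_phi_le x p : berk x -> sdist (phi x) (phiK d f g p) <= sdist x p / res.
Proof.
move=> xP; have N0 := mnorm_gt0 xP; have r0 := res_gt0; have s0 := sdist_ge0 avP xP p.
have Hq := ht_gt0 avP (phiK d f g p).
rewrite sdist_phiB //; apply: (Rle_trans _ (sdist x p / mnorm av f g d x)); last first.
  by apply: Rmult_le_compat_l => //; apply: Rinv_le_contravar => //; apply: mnorm_ge_res.
apply: div_le_of_le_mul; first exact: Rmult_lt_0_compat.
have -> : sdist x p / mnorm av f g d x * (ht av (phiK d f g p) * mnorm av f g d x) =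
   ht av (phiK d f g p) * sdist x p by field; lra.
by case: rep => sf sg _ [fO gO] _; apply: hnorm_pform_phiK.
Qed.

(** * Points of type I and the spherical estimate *)

Definition typeI (p : P1K K) : BPt K := if p is Some a then Some (evalSemi av a) else None.

Lemma typeI_berk p : berk (typeI p).
Proof. by case: p => [a|] //=; apply: evalSemi_mult. Qed.

Lemma sdist_typeI p q : sdist (typeI p) q = sph av q p.
Proof.
rewrite sdistE //; last exact: typeI_berk.
have avV := av_na_val avP.
have X a : msup (evalSemi av a) = Rmax 1 (av a) by rewrite /msup /evalSemi hornerX.
case: p q => [a|] [b|] /=; rewrite ?X //.
- by rewrite /at_root /evalSemi hornerXsubC nv_subC // Rmult_comm.
- by rewrite /Rdiv Rmult_1_l.
- by rewrite /Rdiv Rmult_1_l.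
Qed.

Lemma sdist_ext s t q : berk (Some s) -> berk (Some t) -> (forall b, at_root s b = at_root t b) ->
  sdist (Some s) q = sdist (Some t) q.
Proof.
move=> sP tP h; rewrite !sdistE //; have := h 0%ring; rewrite !at_root0 /msup => ->.
by case: q => [a|] //; rewrite h.
Qed.

(** The two seminorms are given by different formulas and are compared only through their distance
    functions. *)
Lemma sdist_phi_typeI p q : sdist (phi (typeI p)) q = sdist (typeI (phiK d f g p)) q.
Proof.
case: p => [a|]; last by rewrite /=; case: ifP.
have aP := evalSemi_mult avP a.
have phiP : berk (phi (typeI (Some a))) by apply/phiB_berk/typeI_berk.
move: phiP; rewrite /typeI phiB_SomeE /= {1 3}/evalSemi.
case: Req_EM_T => [eg|ng] /= phiP; first by rewrite (av_eq0 avP eg) eqxx.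
have ga : g.[a]%ring != 0%ring.
  by apply/eqP => e; apply: (ng); rewrite e; apply: (nv0 (av_na_val avP)).
rewrite ga; apply: sdist_ext => // [|b]; first exact: evalSemi_mult.
rewrite /at_root; have := push_lform avP f aP ng (Some b); rewrite lformE => ->.
rewrite /evalSemi /pform /= !hornerE -av_div //.
by rewrite mulrBl mulfK // mulr1.
Qed.

Lemma sph_phiK_le x y : sph av (phiK d f g x) (phiK d f g y) <= sph av x y / res.
Proof.
rewrite -!sdist_typeI -sdist_phi_typeI.
by apply: sdist_phi_le; apply: typeI_berk.
Qed.

(** * The estimate for the metric [dFRL] *)

Lemma le_diam_of_le_sdist x c b : berk x -> 0 < c -> (forall p, b <= c * sdist x p) ->
  b <= c * diam x.
Proof.
move=> xP c0 h; apply: le_all_eps => e e0.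
have ec : 0 < e / c by apply: Rdiv_lt_0_compat.
have [p hp] := diamG_approx avP xP ec; apply: Rle_trans (h p) _.
have -> : c * diam x + e = c * (diam x + e / c) by field; lra.
by apply: Rmult_le_compat_l; lra.
Qed.

Lemma join_sym x y : berk x -> berk y -> diam (join x y) = diam (join y x).
Proof.
move=> xP yP; apply: Rle_antisym; apply: le_all_eps => e e0.
  have [p hp] := join_approx avP yP xP e0.
  by have := join_le avP p xP yP; rewrite Rmax_comm; lra.
have [p hp] := join_approx avP xP yP e0.
by have := join_le avP p yP xP; rewrite Rmax_comm; lra.
Qed.

Lemma dFRL_sym x y : berk x -> berk y -> dFRL av x y = dFRL av y x.
Proof. by move=> xP yP; rewrite /dFRL join_sym //; lra. Qed.

(** If [p] nearly attains the joint infimum for [x] and [y], then [phiK d f g p] is a competitor in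
    the infimum for their images. *)
Lemma join_phi_le x y : berk x -> berk y -> diam (join (phi x) (phi y)) <= diam (join x y) / res.
Proof.
move=> xP yP; have r0 := res_gt0; apply: le_div_of_mul_le => //.
apply: le_all_eps => e e0; have [p hp] := join_approx avP xP yP e0.
have := join_le avP (phiK d f g p) (phiB_berk avP f g d xP) (phiB_berk avP f g d yP).
have := sdist_phi_le p xP; have := sdist_phi_le p yP => h1 h2 h.
have {}h := Rle_trans _ _ _ h (Rle_max_compat h2 h1).
rewrite -Rmax_div // in h.
by have := Rmult_le_compat_r _ _ _ (Rlt_le _ _ r0) h; rewrite Rdiv_mulK; lra.
Qed.

Lemma join_le_diam u v : berk u -> berk v -> (forall p, sdist u p <= sdist v p) ->
  diam (join u v) <= diam v.
Proof.
move=> uP vP h; rewrite -(Rmult_1_l (diam v)); apply: le_diam_of_le_sdist => //; first by lra.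
move=> p; rewrite Rmult_1_l; apply: Rle_trans (join_le avP p uP vP) _.
by rewrite Rmax_right //; apply: Rle_refl.
Qed.

(* The image of a radial segment is [<= d] times longer for the logarithmic
   metric: [J^2 <= mu^(2d) * diam (phi u) * diam (phi v)], where [k] and
   [mu^(2d) / k] are the two factors. *)
Lemma dFRL_phi_local u v mu : berk u -> berk v -> 1 <= mu ->
  (forall p, sdist u p <= sdist v p) -> (forall p, sdist v p <= mu * mu * sdist u p) ->
  dFRL av (phi u) (phi v) <= diam v / res * (2 * (1 - / mu ^ d)).
Proof.
move=> uP vP mu1 le_uv le_vu; have r0 := res_gt0.
have fuP := phiB_berk avP f g d uP; have fvP := phiB_berk avP f g d vP.
set J := diam (join (phi u) (phi v)).
have hJ : J <= diam v / res.
  apply: Rle_trans (join_phi_le uP vP) _.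
  apply: Rmult_le_compat_r; first exact/Rlt_le/Rinv_0_lt_compat.
  exact: join_le_diam.
have J0 : 0 <= J by have [[]] := diamG_join avP fuP fvP.
set m := mu ^ d; have m1 : 1 <= m by apply: pow_R1_Rle.
have Lm : (mu * mu) ^ d = m * m by rewrite Rpow_mult_distr.
have huv (h : {poly K}) : (size h <= d.+1)%N -> hnorm av u d h <= hnorm av v d h.
  move=> sh; have := hnorm_le_of_sdist avP uP vP Rle_0_1 _ sh; rewrite pow1 Rmult_1_l; apply.
  by move=> p; rewrite Rmult_1_l.
have hvu (h : {poly K}) : (size h <= d.+1)%N -> hnorm av v d h <= m * m * hnorm av u d h.
  by move=> sh; rewrite -Lm; apply: hnorm_le_of_sdist => //; nra.
have [sf sg _ _ _] := rep.
have Nu := mnorm_gt0 uP; have Nv := mnorm_gt0 vP.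
set a := mnorm av f g d u in Nu; set b := mnorm av f g d v in Nv.
have ab : a <= b by apply: Rle_max_compat; apply: huv.
have ba : b <= m * m * a.
  rewrite /a /mnorm -RmaxRmult; last by nra.
  by apply: Rle_max_compat; apply: hvu.
(* The growth of the denominator in [sdist_phiB] from [u] to [v]. Numerators grow by a factor
   between 1 and [m^2], so [sdist (phi v) <= (m^2 / k) sdist (phi u)] and
   [sdist (phi u) <= k sdist (phi v)]. *)
set k := b / a.
have k1 : 1 <= k by apply: le_div_of_mul_le; lra.
have km : k <= m * m by apply: div_le_of_le_mul.
have bk : b = k * a by rewrite /k Rdiv_mulK; lra.
have szp q : (size (pform f g q) <= d.+1)%N.
  apply: leq_trans (size_polyD _ _) _; rewrite size_polyN geq_max.
  by rewrite !(leq_trans (size_scale_leq _ _)).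
have JA : J <= m * m / k * diam (phi u).
  apply: le_diam_of_le_sdist => // [|q]; first by apply: Rdiv_lt_0_compat; nra.
  apply: Rle_trans (join_le avP q fuP fvP) _.
  have s0 := sdist_ge0 avP fuP q; apply: Rmax_lub.
    rewrite -{1}(Rmult_1_l (sdist _ _)); apply: Rmult_le_compat_r => //.
    by apply: le_div_of_mul_le; lra.
  rewrite !sdist_phiB // -/a -/b bk; have H0 := ht_gt0 avP q.
  apply: div_le_of_le_mul; first by apply: Rmult_lt_0_compat => //; nra.
  have -> : m * m / k * (hnorm av u d (pform f g q) / (ht av q * a)) * (ht av q * (k * a)) =
    m * m * hnorm av u d (pform f g q) by field; lra.
  exact: hvu.
have JB : J <= k * diam (phi v).
  apply: le_diam_of_le_sdist => // [|q]; first by lra.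
  apply: Rle_trans (join_le avP q fuP fvP) _.
  have s0 := sdist_ge0 avP fvP q; apply: Rmax_lub; last first.
    by rewrite -{1}(Rmult_1_l (sdist _ _)); apply: Rmult_le_compat_r.
  rewrite !sdist_phiB // -/a -/b bk; have H0 := ht_gt0 avP q.
  apply: div_le_of_le_mul; first exact: Rmult_lt_0_compat.
  have -> : k * (hnorm av v d (pform f g q) / (ht av q * (k * a))) * (ht av q * a) =
    hnorm av v d (pform f g q) by field; lra.
  exact: huv.
have A1 : J * (k / (m * m)) <= diam (phi u).
  apply: (Rmult_le_reg_l (m * m / k)); first by apply: Rdiv_lt_0_compat; nra.
  have -> : m * m / k * (J * (k / (m * m))) = J by field; lra.
  by [].
have B1 : J * / k <= diam (phi v).
  apply: (Rmult_le_reg_l k); first by lra.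
  have -> : k * (J * / k) = J by field; lra.
  by [].
(* The arithmetic-geometric mean inequality removes the unknown [k]. *)
have agm : 2 * / m <= k / (m * m) + / k.
  have -> : k / (m * m) + / k = 2 * / m + (k - m) * (k - m) / (m * m * k) by field; lra.
  have : 0 <= (k - m) * (k - m) / (m * m * k) by apply: div_ge0; [exact: Rle_0_sqr | apply: Rmult_lt_0_compat; nra].
  by lra.
have im : / m <= 1 by rewrite -Rinv_1; apply: Rinv_le_contravar; lra.
apply: (Rle_trans _ (J * (2 * (1 - / m)))); last by apply: Rmult_le_compat_r => //; lra.
have : J * (2 * / m) <= J * (k / (m * m) + / k) by apply: Rmult_le_compat_l.
by rewrite /dFRL -/J; lra.
Qed.

(** The local estimate with [mu^2 = c / c']. For [t = 1 / mu], [2 c (1 - t^d) <= 2 c d (1 - t) = d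
    (c - c') * 2 / (1 + t)], and [2 / (1 + t) <= mu]. *)
Lemma dFRL_phi_step x u v c c' : berk x -> berk u -> berk v ->
  (forall p, sdist u p = Rmax (sdist x p) c') -> (forall p, sdist v p = Rmax (sdist x p) c) ->
  0 < c' <= c -> diam x <= c' ->
  dFRL av (phi u) (phi v) <= INR d / res * (c - c') * sqrt (c / c').
Proof.
move=> xP uP vP hu hv [c0 cc] dx; have r0 := res_gt0.
have l1 : 1 <= c / c' by apply: le_div_of_mul_le; lra.
set mu := sqrt (c / c').
have mm : mu * mu = c / c' by apply: sqrt_sqrt; lra.
have mu1 : 1 <= mu by rewrite -sqrt_1; apply: sqrt_le_1; lra.
have dv : diam v = c by rewrite (diamG_max avP vP xP hv) Rmax_right //; lra.
apply: (Rle_trans _ (c / res * (2 * (1 - / mu ^ d)))).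
  rewrite -{1}dv; apply: dFRL_phi_local => // p; rewrite hu hv.
    by apply: Rle_max_compat; lra.
  rewrite mm -RmaxRmult; last by lra.
  apply: Rle_max_compat; last by rewrite Rdiv_mulK; lra.
  by have := sdist_ge0 avP xP p; nra.
have -> : INR d / res * (c - c') * mu = / res * (INR d * (c - c') * mu) by rewrite /Rdiv; ring.
have -> : c / res * (2 * (1 - / mu ^ d)) = / res * (c * (2 * (1 - / mu ^ d))) by rewrite /Rdiv; ring.
apply: Rmult_le_compat_l; first exact/Rlt_le/Rinv_0_lt_compat.
set t := / mu; have tm : t * mu = 1 by rewrite /t Rinv_l; lra.
have t1 : 0 < t <= 1.
  split; first by apply: Rinv_0_lt_compat; lra.
  by rewrite /t -Rinv_1; apply: Rinv_le_contravar; lra.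
have ec : c' = c * (t * t).
  have : c = c' * (mu * mu) by rewrite mm; field; lra.
  move=> ->; replace (c' * (mu * mu) * (t * t)) with (c' * ((t * mu) * (t * mu))) by ring.
  by rewrite tm; ring.
have bn : 1 - t ^ d <= INR d * (1 - t) by apply: one_sub_pow_le; lra.
rewrite -pow_inv -/t.
apply: (Rle_trans _ (c * (2 * (INR d * (1 - t))))).
  by apply: Rmult_le_compat_l; lra.
have -> : INR d * (c - c') * mu = c * (INR d * (1 - t)) * ((1 + t) * mu) by rewrite ec; ring.
have -> : c * (2 * (INR d * (1 - t))) = c * (INR d * (1 - t)) * 2 by ring.
apply: Rmult_le_compat_l; last by rewrite Rmult_plus_distr_r tm; lra.
by apply: Rmult_le_pos; [lra | apply: Rmult_le_pos; [exact: pos_INR | lra]].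
Qed.

(* Subdividing into steps of ratio [mu] improves the factor of [dFRL_phi_step] to [mu]. *)
Lemma dFRL_phi_chain x mu N : berk x -> 1 < mu -> forall u v c c', berk u -> berk v ->
  (forall p, sdist u p = Rmax (sdist x p) c') -> (forall p, sdist v p = Rmax (sdist x p) c) ->
  0 < c' <= c -> c <= 1 -> diam x <= c' -> c <= c' * mu ^ N ->
  dFRL av (phi u) (phi v) <= INR d / res * (c - c') * mu.
Proof.
move=> xP mu1; have r0 := res_gt0.
have L0 : 0 <= INR d / res by apply: div_ge0 => //; apply: pos_INR.
have short u v c c' : berk u -> berk v ->
    (forall p, sdist u p = Rmax (sdist x p) c') -> (forall p, sdist v p = Rmax (sdist x p) c) ->
    0 < c' <= c -> diam x <= c' -> c <= c' * mu ->
    dFRL av (phi u) (phi v) <= INR d / res * (c - c') * mu.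
  move=> uP vP hu hv [c0 cc] dx hc.
  apply: Rle_trans (dFRL_phi_step xP uP vP hu hv (conj c0 cc) dx) _.
  apply: Rmult_le_compat_l; first by apply: Rmult_le_pos; lra.
  have l1 : c / c' <= mu by apply: div_le_of_le_mul; lra.
  apply: (Rle_trans _ (sqrt (mu * mu))); last by rewrite sqrt_square; lra.
  by apply: sqrt_le_1_alt; nra.
elim: N => [|N IH] u v c c' uP vP hu hv [c0 cc] c1 dx hN.
  by apply: short => //; rewrite /= in hN; nra.
case: (Rle_or_lt c (c' * mu)) => [|hc]; first exact: short.
have w01 : 0 <= c' * mu <= 1 by nra.
(* The point at level [c' mu] cuts off one short step. *)
have [w wP hw] := on_ray_exists avP xP w01.
apply: Rle_trans (dFRL_triangle avP (phiB_berk avP f g d uP) (phiB_berk avP f g d wP)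
  (phiB_berk avP f g d vP)) _.
have s1 : dFRL av (phi w) (phi v) <= INR d / res * (c - c' * mu) * mu.
  by apply: IH => //; [nra | nra | move: hN => /=; lra].
have s2 : dFRL av (phi u) (phi w) <= INR d / res * (c' * mu - c') * mu.
  by apply: short => //; [nra | lra].
by lra.
Qed.

Lemma dFRL_phi_segment x u v c c' : berk x -> berk u -> berk v ->
  (forall p, sdist u p = Rmax (sdist x p) c') -> (forall p, sdist v p = Rmax (sdist x p) c) ->
  0 < c' <= c -> c <= 1 -> diam x <= c' ->
  dFRL av (phi u) (phi v) <= INR d / res * (c - c').
Proof.
move=> xP uP vP hu hv [c0 cc] c1 dx; have r0 := res_gt0.
have L0 : 0 <= INR d / res by apply: div_ge0 => //; apply: pos_INR.
set B := INR d / res * (c - c'); have B0 : 0 <= B by apply: Rmult_le_pos; lra.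
(* As [mu] tends to 1 the extra factor disappears; this choice gives [B mu <= B + e], also for
   [B = 0]. *)
apply: le_all_eps => e e0; pose mu := 1 + e / (B + 1).
have h : 0 < e / (B + 1) by apply: Rdiv_lt_0_compat; lra.
have mu1 : 1 < mu by rewrite /mu; lra.
have [N hN] : exists N, c <= c' * mu ^ N.
  have [N hN] := Pow_x_infinity mu (Rlt_le_trans _ _ _ mu1 (Rle_abs _)) (c / c').
  exists N; have := hN N (le_n N); rewrite Rabs_right; last by apply/Rle_ge/pow_le; lra.
  by move=> /Rge_le hh; have := le_mul_of_div_le c0 hh; lra.
apply: Rle_trans (dFRL_phi_chain xP mu1 uP vP hu hv (conj c0 cc) c1 dx hN) _.
rewrite -/B /mu; have : B * (e / (B + 1)) <= (B + 1) * (e / (B + 1)) by apply: Rmult_le_compat_r; lra.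
have -> : (B + 1) * (e / (B + 1)) = e by field; lra.
by lra.
Qed.

Lemma dFRL_phi_ray x z c : berk x -> berk z -> 0 <= c <= 1 ->
  (forall p, sdist z p = Rmax (sdist x p) c) -> diam x <= c ->
  dFRL av (phi x) (phi z) <= INR d / res * (c - diam x).
Proof.
move=> xP zP [c0 c1] hz dx; have r0 := res_gt0; have x0 := diamG_ge0 avP xP.
have L0 : 0 <= INR d / res by apply: div_ge0 => //; apply: pos_INR.
case: (Rle_lt_or_eq_dec _ _ x0) => [xp|xe].
  (* When [diam x > 0], [x] itself is the point at level [diam x] of its path. *)
  apply: (@dFRL_phi_segment x x z) => //; last exact: Rle_refl.
  by move=> p; rewrite Rmax_left //; apply: diamG_le.
rewrite -xe Rminus_0_r.
(* [x] has infinite logarithmic distance to [z], so the path is started at a small [c' > 0]. *)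
have near w c' : berk w -> (forall p, sdist w p = Rmax (sdist x p) c') -> 0 <= c' ->
    dFRL av (phi x) (phi w) <= 2 * (c' / res).
  move=> wP hw c'0.
  have dw : diam w = c' by rewrite (diamG_max avP wP xP hw) Rmax_right //; lra.
  have : diam (join (phi x) (phi w)) <= c' / res.
    apply: Rle_trans (join_phi_le xP wP) _.
    apply: Rmult_le_compat_r; first exact/Rlt_le/Rinv_0_lt_compat.
    by rewrite -dw; apply: join_le_diam => // p; rewrite hw; apply: Rmax_l.
  have := diamG_ge0 avP (phiB_berk avP f g d xP); have := diamG_ge0 avP (phiB_berk avP f g d wP).
  by rewrite /dFRL; lra.
case: (Req_dec c 0) => [ec|nc].
  have := near z c zP hz c0; rewrite ec /Rdiv Rmult_0_l; lra.
(* The bound on [c'] makes the initial piece cost at most [e], by [near]. *)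
apply: le_all_eps => e e0; pose c' := Rmin c (e * res / 2).
have c'0 : 0 < c' by apply: Rmin_glb_lt; nra.
have c'c : c' <= c by apply: Rmin_l.
have c'e : c' <= e * res / 2 by apply: Rmin_r.
have c'01 : 0 <= c' <= 1 by lra.
have [w wP hw] := on_ray_exists avP xP c'01.
apply: Rle_trans (dFRL_triangle avP (phiB_berk avP f g d xP) (phiB_berk avP f g d wP) (phiB_berk avP f g d zP)) _.
have h1 := near w c' wP hw (Rlt_le _ _ c'0).
have h2 : 2 * (c' / res) <= e.
  have : c' / res <= e / 2 by apply: div_le_of_le_mul; lra.
  by lra.
have h3 : dFRL av (phi w) (phi z) <= INR d / res * (c - c').
  by apply: (@dFRL_phi_segment x) => //; lra.
by nra.
Qed.

(** The point [z], at the level of the join, lies on the paths of both [x] and [y], and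
    [dFRL av x y] is the sum of the two drops in diameter from [z]. *)
Lemma dFRL_phi_le x y : berk x -> berk y -> dFRL av (phi x) (phi y) <= INR d / res * dFRL av x y.
Proof.
move=> xP yP; have [J01 [lb ap]] := diamG_join avP xP yP.
have [dx dy] := diamG_le_join avP xP yP.
have [z zP hz] := on_ray_exists avP xP J01.
have hz' p : sdist z p = Rmax (sdist y p) (diam (join x y)).
  by rewrite hz; apply: (sdist_merge_inf avP xP yP ap).
have fx := phiB_berk avP f g d xP; have fy := phiB_berk avP f g d yP.
have fz := phiB_berk avP f g d zP.
apply: Rle_trans (dFRL_triangle avP fx fz fy) _; rewrite (dFRL_sym fz fy).
have := dFRL_phi_ray xP zP J01 hz dx; have := dFRL_phi_ray yP zP J01 hz' dy.
have -> : dFRL av x y = (diam (join x y) - diam x) + (diam (join x y) - diam y) by rewrite /dFRL; lra.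
by rewrite Rmult_plus_distr_l => h1 h2; apply: Rplus_le_compat.
Qed.

End Lipschitz.

Theorem theorem1 (K : closedFieldType) (av : K -> R)
  (Hav : complete_na_abs av)
  (d : nat) (hd : leq 1 d) (f g : {poly K})
  (Hrep : normalized_rep av d f g) :
  (forall x y : P1K K, x <> y ->
     Rle (Rdiv (sph av (phiK d f g x) (phiK d f g y)) (sph av x y))
         (Rdiv R1 (av (Res d f g)))) /\
  (forall x y : BPt K, isBerk av x -> isBerk av y -> x <> y ->
     Rle (Rdiv (dFRL av (phiB av d f g x) (phiB av d f g y)) (dFRL av x y))
         (Rmax (Rdiv (INR d) (av (Res d f g)))
               (Rdiv R1 (pow (av (Res d f g)) d)))).
Proof.
have avP : is_na_abs av by case: Hav.
have r0 := res_gt0 avP Hrep.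
split=> [x y _|x y xP yP _].
  apply: ratio_le.
  - by rewrite -sdist_typeI //; apply: sdist_ge0 => //; apply: typeI_berk.
  - by apply: div_ge0 => //; apply: Rle_0_1.
  - by rewrite /Rdiv Rmult_1_l Rmult_comm; apply: sph_phiK_le.
apply: Rle_trans (Rmax_l _ _); apply: ratio_le; first exact: dFRL_ge0.
- by apply: div_ge0 => //; apply: pos_INR.
- exact: dFRL_phi_le.
Qed.
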